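(* Let $F$ be a locally subcritical nonlinearity, let $T=\mathcal H_F$ with $T_\gamma=\mathrm{span}\{\tau\in\mathcal F_F:|\tau|_{\mathfrak s}=\gamma\}$, $A=\{|\tau|_{\mathfrak s}:\tau\in\mathcal F_F\}$, and let $G_F$ be the group of operators on $\mathcal H_F$ defined in the context. Then $\mathscr T_F=(A,\mathcal H_F,G_F)$ defines a regularity structure. Furthermore, $\mathcal I$ is an abstract integration map of order $\beta$ for $\mathscr T_F$.
   Context: Regularity structure: a triple $(A,T,G)$ where $A\subset\mathbb R$ contains $0$, is bounded from below and locally finite; $T=\bigoplus_{\alpha\in A}T_\alpha$ with each $T_\alpha$ a Banach space and $T_0\simeq\mathbb R$ with unit vector $\mathbf 1$; $G$ is a group of linear operators on $T$ with $\Gamma\mathbf 1=\mathbf 1$ and $\Gamma a-a\in\bigoplus_{\beta<\alpha}T_\beta$ for all $\Gamma\in G$, $a\in T_\alpha$. A sector is a $G$-invariant graded subspace (complemented in each degree, with degrees bounded below). An abstract integration map of order $\beta$ on a sector $V$ is a linear map $\mathcal I:V\to T$ with $\mathcal I:V_\alpha\to T_{\alpha+\beta}$, $\mathcal Ia=0$ for $a\in V\cap\bar T$, and $\mathcal I\Gamma a-\Gamma\mathcal Ia\in\bar T$ for $a\in V$, $\Gamma\in G$, where $\bar T$ is the span of the monomials $X^k$. Data: a dimension $d$, a scaling $\mathfrak s\in\mathbb N^d$ (strictly positive relatively prime integers), $|k|_{\mathfrak s}=\sum_i\mathfrak s_ik_i$ for multiindices $k\in\mathbb N^d$, numbers $\beta>0$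 and $\alpha<0$, and a smooth function $F=F(u,\nabla u,\xi)$, affine in $\xi$ (the nonlinearity of $u=K*F(u,\nabla u,\xi)+\tilde u_0$, where $K$ improves regularity by $\beta$ and $\xi$ has regularity $\alpha$). Local subcriticality: in the expression of $F$, replace $\xi$ by a dummy variable $\Xi$; for each $i$ with $\beta+\alpha\le\mathfrak s_i$ replace $\partial_iu$ by a dummy variable $P_i$; if $\beta+\alpha\le0$ replace $u$ by a dummy variable $U$. The resulting expression is assumed polynomial in the dummy variables. Give $\Xi,U,P_i$ homogeneities $\alpha$, $\beta+\alpha$, $\beta+\alpha-\mathfrak s_i$ (additive under products). $F$ is locally subcritical if terms containing $\Xi$ do not contain the other dummy variables and all remaining monomials have homogeneity strictly greater than $\alpha$. Formal expressions: $\mathcal F$ is the set of formal expressions generated from symbols $\mathbf 1,\Xi,X_1,\dots,X_d$ by a commutative associative product with unit $\mathbf 1$ and by maps $\tau\mapsto\mathcal I_k(\tau)$, $k\in\mathbb N^d$, expressions containing a factor $\mathcal I_k(X^\ell)$ being excluded (one sets $\mathcal I_k(X^\ell)=0$ and likewise $\mathcal J_k(X^\ell)=0$ below). $\mathcal I=\mathcal I_0$, $\mathcal I_i=\mathcal I_{e_i}$. Weights: $|\mathbf 1|_{\mathfrak s}=0$, $|\Xi|_{\mathfrak s}=\alpha$, $|X_i|_{\mathfrak s}=\mathfrak s_i$, $|\tau\bar\tau|_{\mathfrak s}=|\tau|_{\mathfrak s}+|\bar\tau|_{\mathfrak s}$, $|\mathcal I_k(\tau)|_{\mathfrak s}=|\tau|_{\mathfrak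 s}+\beta-|k|_{\mathfrak s}$. $\mathfrak M_F$ is the set of monomials $\Xi^mU^nP^k$ such that $F$ contains a term of the type $\xi^{\bar m}u^{\bar n}(Du)^{\bar k}$ with $\bar m\ge m$, $\bar n\ge n$, $\bar k\ge k$ (non-polynomial functions $g(u)$ being counted as $u^\infty$, and similarly for derivatives). Set $\mathcal W_0=\mathcal U_0=\mathcal P_0^i=\emptyset$ and, for $n\ge1$, $$\mathcal W_n=\mathcal W_{n-1}\cup\bigcup_{\mathcal Q\in\mathfrak M_F}\mathcal Q(\mathcal U_{n-1},\mathcal P_{n-1},\Xi),\quad\mathcal U_n=\{X^k\}\cup\{\mathcal I(\tau):\tau\in\mathcal W_n\},\quad\mathcal P_n^i=\{X^k\}\cup\{\mathcal I_i(\tau):\tau\in\mathcal W_n\},$$ where $k$ ranges over all multiindices and $\mathcal Q(\cdot)$ means substituting in $\mathcal Q$ each occurrence of $U$ by some element of $\mathcal U_{n-1}$ and each occurrence of $P_i$ by some element of $\mathcal P^i_{n-1}$. Set $\mathcal F_F=\bigcup_n(\mathcal W_n\cup\mathcal U_n)$ and let $\mathcal H_F$, $\mathcal H$ be the linear spans of $\mathcal F_F$, $\mathcal F$. It is assumed that $\mathbf 1$ is the only element of $\mathcal F_F$ of weight $0$. The map $\mathcal I$ acts on the span of $\bigcup_n\mathcal W_n$. $\mathcal F_+$ is the set of formal expressions $X^k\prod_j\mathcal J_{k_j}\tau_j$ (finite products) with $\tau_j\in\mathcal F$ and $|\tau_j|_{\mathfrak s}+\beta-|k_j|_{\mathfrak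 s}>0$; $\mathcal F_F^+$ is the subset with $\tau_j\in\mathcal F_F$. $\mathcal H_+$, $\mathcal H_F^+$ are their linear spans (free commutative algebras). $\mathcal J_k\tau:=0$ if $|\tau|_{\mathfrak s}+\beta-|k|_{\mathfrak s}\le0$. Linear maps $\Delta:\mathcal H\to\mathcal H\otimes\mathcal H_+$ and $\Delta^+:\mathcal H_+\to\mathcal H_+\otimes\mathcal H_+$ are defined by $\Delta\mathbf 1=\mathbf 1\otimes\mathbf 1$, $\Delta X_i=X_i\otimes\mathbf 1+\mathbf 1\otimes X_i$ (same for $\Delta^+$), $\Delta\Xi=\Xi\otimes\mathbf 1$, both multiplicative, and $$\Delta(\mathcal I_k\tau)=(\mathcal I_k\otimes I)\Delta\tau+\sum_{\ell,m}\frac{X^\ell}{\ell!}\otimes\frac{X^m}{m!}\mathcal J_{k+\ell+m}\tau,\qquad\Delta^+(\mathcal J_k\tau)=\sum_\ell\Bigl(\mathcal J_{k+\ell}\otimes\frac{(-X)^\ell}{\ell!}\Bigr)\Delta\tau+\mathbf 1\otimes\mathcal J_k\tau .$$ These restrict to maps $\mathcal H_F\to\mathcal H_F\otimes\mathcal H_F^+$ and $\mathcal H_F^+\to\mathcal H_F^+\otimes\mathcal H_F^+$. The structure group $G$ consists of the multiplicative linear functionals $g:\mathcal H_+\to\mathbb R$ (with $g(\mathbf 1)=1$), with product $g\circ\bar g=(g\otimes\bar g)\Delta^+$, acting by $\Gamma_g\tau=(I\otimes g)\Delta\tau$; $G_F$ is the resulting group of operators on $\mathcal H_F$ (quotient of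 $G$ by identifying elements acting identically). *)

(* Defs.v *)
From HB Require Import structures.
From mathcomp Require Import all_boot all_order all_algebra finmap.
From mathcomp Require Import generic_quotient.
From mathcomp Require Import all_classical all_reals all_analysis.
(* The notations of [monalg] clash with those of mathcomp-analysis. *)
From mathcomp Require Import -(notations) monalg.

Set Implicit Arguments.
Unset Strict Implicit.
Unset Printing Implicit Defensive.

Import Order.TTheory GRing.Theory Num.Theory numFieldNormedType.Exports.
Local Open Scope classical_set_scope.
Local Open Scope quotient_scope.
Local Open Scope ring_scope.

(** * Linear spans *)

Definition lspan (R : realType) (V : lmodType R) (S : set V) : set V :=
  [set x | exists (n : nat) (c : 'I_n -> R) (v : 'I_n -> V),
     (forall i, S (v i)) /\ x = \sum_(i < n) c i *: v i].

Lemma lspan_submod_closed (R : realType) (V : lmodType R) (S : set V) :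
  submod_closed (fun x => `[< lspan S x >]).
Proof.
split; first by apply/asboolP; exists 0%N, (fun=> 0), (fun=> 0); split;
  [case|rewrite big_ord0].
move=> a x y /asboolP[n [c [v [Sv ->]]]] /asboolP[m [b [w [Sw ->]]]].
apply/asboolP; exists (n + m)%N.
exists (fun i : 'I_(n + m) => match fintype.split i with inl j => a * c j | inr j => b j end).
exists (fun i : 'I_(n + m) => match fintype.split i with inl j => v j | inr j => w j end).
split; first by move=> i; case: (fintype.split i).
rewrite big_split_ord scaler_sumr /=; congr (_ + _); apply: eq_bigr => i _.
- by rewrite (unsplitK (inl i)) scalerA.
- by rewrite (unsplitK (inr i)).
Qed.

Section SpanType.
Variables (R : realType) (V : lmodType R) (S : set V).

Definition lspan_pred : {pred V} := fun x => `[< lspan S x >].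

HB.instance Definition _ :=
  GRing.isSubmodClosed.Build R V lspan_pred (lspan_submod_closed S).

(* The subspace [lspan S], as an lmodType of its own. *)
Record span_type := SpanType {
  span_val : V;
  _ : span_val \in lspan_pred }.

HB.instance Definition _ := [isSub for span_val].
HB.instance Definition _ := [Choice of span_type by <:].
HB.instance Definition _ :=
  [SubChoice_isSubLmodule of span_type by <:].

End SpanType.

(** * Regularity structures *)

Section RegularityStructure.
Variables (R : realType) (T : lmodType R).

(* [T] is the (algebraic) direct sum of the [C g], [g] in [A] *)
Definition direct_sum (A : set R) (C : R -> set T) : Prop :=
  forall a : T, exists! f : R -> T,
    [/\ forall g, A g -> C g (f g),
        forall g, ~ A g -> f g = 0,
        finite_set [set g | f g != 0] &
        a = \sum_(g \in A) f g].

(* The Banach spaces [T_g], [g] in [A], are given as complete normed modules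
   [E g] with embeddings [io g] into [T]; [E g] is irrelevant if [g] is not in
   [A], in which case [T_g] is zero. *)
Variables (A : set R) (E : R -> completeNormedModType R).
Variable (io : forall g, {linear E g -> T}).

Definition homog (g : R) : set T :=
  [set a | a = 0 \/ (A g /\ range (io g) a)].

Record is_regularity_structure (one : T) (G : set (T -> T)) : Prop := {
  rs_index0 : A 0;
  rs_index_lbound : has_lbound A;
  rs_index_locally_finite : forall x y : R, finite_set (A `&` `[x, y]);
  rs_inj : forall g, A g -> injective (io g);
  rs_direct_sum : direct_sum A (fun g => range (io g));
  rs_unit : exists e : E 0,
    [/\ io 0 e = one, `|e| = 1 & forall x : E 0, exists c : R, x = c *: e];
  rs_linear : forall Gam, G Gam -> linear Gam;
  rs_group1 : G idfun;
  rs_groupM : forall Gam Gam', G Gam -> G Gam' -> G (Gam \o Gam');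
  rs_groupV : forall Gam, G Gam ->
    exists2 Gam', G Gam' & cancel Gam Gam' /\ cancel Gam' Gam;
  rs_fix_unit : forall Gam, G Gam -> Gam one = one;
  rs_triangular : forall Gam g a, G Gam -> A g -> homog g a ->
    lspan (\bigcup_(b in [set b | A b /\ b < g]) homog b) (Gam a - a) }.

Definition is_subspace (V : set T) : Prop :=
  V 0 /\ forall (c : R) x y, V x -> V y -> V (c *: x + y).

Record is_sector (G : set (T -> T)) (V : set T) : Prop := {
  sector_subspace : is_subspace V;
  sector_graded : V `<=` lspan (\bigcup_(g in A) (V `&` homog g));
  sector_lbound : exists c : R, forall g, g < c -> V `&` homog g `<=` [set 0];
  (* topological complement in the Banach space [E g] *)
  sector_complemented : forall g, A g -> exists W : set T,
    [/\ is_subspace W /\ W `<=` homog g,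
        forall a, homog g a -> exists v w, [/\ V v, W w & a = v + w],
        V `&` W `<=` [set 0],
        closed (io g @^-1` V) &
        closed (io g @^-1` W)];
  sector_invariant : forall Gam a, G Gam -> V a -> V (Gam a) }.

(* [Tbar] is the span of the monomials [X^k]; only the values of [I] on [V]
   matter. *)
Record is_abstract_integration_map (G : set (T -> T)) (Tbar : set T)
    (beta : R) (V : set T) (I : T -> T) : Prop := {
  aim_sector : is_sector G V;
  aim_linear : forall (c : R) x y, V x -> V y -> I (c *: x + y) = c *: I x + I y;
  aim_degree : forall g a, V a -> homog g a -> homog (g + beta) (I a);
  aim_poly : forall a, V a -> Tbar a -> I a = 0;
  aim_commute : forall Gam a, G Gam -> V a -> Tbar (I (Gam a) - Gam (I a)) }.

End RegularityStructure.

(** * Multiindices *)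

Notation mindex d := {ffun 'I_d -> nat}.

Definition mfact (d : nat) (k : mindex d) : nat := (\prod_i (k i)`!)%N.

Definition munit (d : nat) (i : 'I_d) : mindex d := [ffun j => (i == j) : nat].

Definition is_scaling (d : nat) (s : 'I_d -> nat) : Prop :=
  (forall i, 0 < s i)%N /\ (\big[gcdn/0%N]_i s i = 1)%N.

Definition mweight (R : realType) (d : nat) (s : 'I_d -> nat) (k : mindex d) : R :=
  (\sum_i s i * k i)%N%:R.

(** * Formal expressions *)

Section FormalExpressions.
Variable d : nat.

Inductive expr : Type :=
  | EOne
  | EXi
  | EX of 'I_d
  | EMul of expr & expr
  | EI of mindex d & expr.

HB.instance Definition _ := gen_eqMixin expr.
HB.instance Definition _ := gen_choiceMixin expr.

(* [e] denotes some monomial [X^l] *)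
Fixpoint is_mono (e : expr) : bool :=
  match e with
  | EOne | EX _ => true
  | EMul a b => is_mono a && is_mono b
  | EXi | EI _ _ => false
  end.

(* no factor [I_k(X^l)], at any depth *)
Fixpoint admissible (e : expr) : bool :=
  match e with
  | EOne | EXi | EX _ => true
  | EMul a b => admissible a && admissible b
  | EI _ a => admissible a && ~~ is_mono a
  end.

(* the congruence generated by the laws of a commutative monoid *)
Inductive eqv : expr -> expr -> Prop :=
  | eqv_refl a : eqv a a
  | eqv_sym a b : eqv a b -> eqv b a
  | eqv_trans b a c : eqv a b -> eqv b c -> eqv a c
  | eqv_mulC a b : eqv (EMul a b) (EMul b a)
  | eqv_mulA a b c : eqv (EMul a (EMul b c)) (EMul (EMul a b) c)
  | eqv_mul1 a : eqv (EMul EOne a) a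
  | eqv_mul a a' b b' : eqv a a' -> eqv b b' -> eqv (EMul a b) (EMul a' b')
  | eqv_int k a a' : eqv a a' -> eqv (EI k a) (EI k a').

Record aexpr := AExpr { ae_val : expr; ae_adm : admissible ae_val }.
HB.instance Definition _ := [isSub for ae_val].
HB.instance Definition _ := [Choice of aexpr by <:].

Definition aeqv (a b : aexpr) : bool := `[< eqv (val a) (val b) >].

Lemma aeqv_refl : reflexive aeqv.
Proof. by move=> a; apply/asboolP; exact: eqv_refl. Qed.
Lemma aeqv_sym : symmetric aeqv.
Proof. by move=> a b; apply/asboolP/asboolP => /eqv_sym. Qed.
Lemma aeqv_trans : transitive aeqv.
Proof.
by move=> b a c /asboolP ab /asboolP bc; apply/asboolP; exact: eqv_trans ab bc.
Qed.

Canonical aeqv_equiv := EquivRel aeqv aeqv_refl aeqv_sym aeqv_trans.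

(* the set of formal expressions *)
Definition fexpr := {eq_quot aeqv_equiv}.
HB.instance Definition _ := Choice.on fexpr.
HB.instance Definition _ := EqQuotient.on fexpr.

Definition frepr (t : fexpr) : expr := val (repr t).

Lemma frepr_adm (t : fexpr) : admissible (frepr t).
Proof. exact: valP. Qed.

Definition fone : fexpr := \pi_fexpr (@AExpr EOne erefl).
Definition fXi : fexpr := \pi_fexpr (@AExpr EXi erefl).
Definition fX (i : 'I_d) : fexpr := \pi_fexpr (@AExpr (EX i) erefl).

Lemma fmul_adm (t u : fexpr) : admissible (EMul (frepr t) (frepr u)).
Proof. by rewrite /= !frepr_adm. Qed.

Definition fmul (t u : fexpr) : fexpr := \pi_fexpr (AExpr (fmul_adm t u)).

Lemma fexpr_eqP (t u : fexpr) : t = u <-> eqv (frepr t) (frepr u).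
Proof.
split=> [->|tu]; first exact: eqv_refl.
rewrite -[t]reprK -[u]reprK; apply/eqquotP; exact/asboolP.
Qed.

Lemma frepr_pi (a : aexpr) : eqv (frepr (\pi_fexpr a)) (val a).
Proof. by apply/asboolP; apply/(@eqquotP _ _ fexpr); rewrite reprK. Qed.

Lemma frepr_mul (t u : fexpr) :
  eqv (frepr (fmul t u)) (EMul (frepr t) (frepr u)).
Proof. exact: frepr_pi. Qed.

Lemma fmulA : associative fmul.
Proof.
move=> t u v; apply/fexpr_eqP.
apply: eqv_trans (frepr_mul _ _) _.
apply: eqv_trans (eqv_mul (eqv_refl _) (frepr_mul _ _)) _.
apply: eqv_trans (eqv_mulA _ _ _) _; apply: eqv_sym.
apply: eqv_trans (frepr_mul _ _) _.
exact: eqv_mul (frepr_mul _ _) (eqv_refl _).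
Qed.

Lemma fmulC : commutative fmul.
Proof.
move=> t u; apply/fexpr_eqP.
apply: eqv_trans (frepr_mul _ _) _; apply: eqv_trans (eqv_mulC _ _) _.
exact: eqv_sym (frepr_mul _ _).
Qed.

Lemma fmul1 : left_id fone fmul.
Proof.
move=> t; apply/fexpr_eqP; apply: eqv_trans (frepr_mul _ _) _.
by apply: eqv_trans (eqv_mul (frepr_pi _) (eqv_refl _)) _; exact: eqv_mul1.
Qed.

Lemma fmulr1 : right_id fone fmul.
Proof. by move=> t; rewrite fmulC fmul1. Qed.

Fixpoint natoms (e : expr) : nat :=
  match e with
  | EOne => 0
  | EMul a b => natoms a + natoms b
  | _ => 1
  end.

Lemma natoms_eqv a b : eqv a b -> natoms a = natoms b.
Proof.
elim=> //= [? b' ? _ -> _ -> //|? ?|? ? ?|? ? ? ? _ -> _ -> //].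
- exact: addnC.
- exact: addnA.
Qed.

Lemma natoms0 a : natoms a = 0%N -> eqv a EOne.
Proof.
elim: a => //= [_|a iha b ihb /eqP]; first exact: eqv_refl.
rewrite addn_eq0 => /andP[/eqP/iha a1 /eqP/ihb b1].
exact: eqv_trans (eqv_mul a1 b1) (eqv_mul1 _).
Qed.

Lemma fmul_eq1 t u : fmul t u = fone -> t = fone /\ u = fone.
Proof.
move=> /fexpr_eqP tu1.
have := natoms_eqv (eqv_trans (eqv_sym (frepr_mul _ _)) tu1).
rewrite (natoms_eqv (frepr_pi _)) /= => /eqP; rewrite addn_eq0.
move=> /andP[/eqP t0 /eqP u0]; split; apply/fexpr_eqP;
  by apply: eqv_trans (natoms0 _) _ => //; exact: eqv_sym (frepr_pi (@AExpr EOne erefl)).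
Qed.

HB.instance Definition _ :=
  Choice_isMonomialDef.Build fexpr fmulA fmul1 fmulr1 fmul_eq1.
HB.instance Definition _ := MonomialDef_isConomialDef.Build fexpr fmulC.

Definition fpow (t : fexpr) (n : nat) : fexpr := iter n (fmul t) fone.

Definition fXpow (k : mindex d) : fexpr := \big[fmul/fone]_i fpow (fX i) (k i).

(* [I_k(t)], undefined if [t] is some [X^l] *)
Definition fI (k : mindex d) (t : fexpr) : option fexpr :=
  omap (fun a : aexpr => \pi_fexpr a) (insub (EI k (frepr t))).

Definition fmono (t : fexpr) : bool := is_mono (frepr t).

Section Weight.
Variables (R : realType) (s : 'I_d -> nat) (alpha beta : R).

Fixpoint eweight (e : expr) : R :=
  match e with
  | EOne => 0
  | EXi => alpha
  | EX i => (s i)%:R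
  | EMul a b => eweight a + eweight b
  | EI k a => eweight a + beta - mweight R s k
  end.

Definition fweight (t : fexpr) : R := eweight (frepr t).

End Weight.
End FormalExpressions.

(** * The nonlinearity *)

(* Iterated directional derivatives; on a finite dimensional [V] this is the
   usual notion of a C^n function. *)
Fixpoint is_C (R : realType) (V : normedModType R) (n : nat) (f : V -> R) : Prop :=
  if n is m.+1 then
    (forall x v, derivable f x v) /\ (forall v, is_C m (fun x => 'D_v f x))
  else continuous f.

Definition smooth (R : realType) (V : normedModType R) (f : V -> R) : Prop :=
  forall n, is_C n f.

Section Nonlinearity.
Variables (R : realType) (d : nat).

(* A term of type [xi^m u^n (Du)^k]: the exponents [n] and [k_i] are natural
   numbers or infinite ([None]).  The variables of infinite exponent are those
   on which the coefficient depends in a non-polynomial way. *)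
Record nl_term := NlTerm {
  nt_xi : nat;
  nt_u : option nat;
  nt_du : 'I_d -> option nat;
  nt_coef : R -> 'rV[R]_d -> R }.

Definition nt_eval (t : nl_term) (u : R) (p : 'rV[R]_d) (xi : R) : R :=
  nt_coef t u p * xi ^+ nt_xi t * u ^+ odflt 0%N (nt_u t)
    * \prod_i p ord0 i ^+ odflt 0%N (nt_du t i).

Definition set_coord (p : 'rV[R]_d) (i : 'I_d) (x : R) : 'rV[R]_d :=
  \row_j (if j == i then x else p ord0 j).

Definition polynomial_in_u (c : R -> 'rV[R]_d -> R) : Prop :=
  exists N : nat, forall p, exists q : {poly R},
    (size q <= N)%N /\ forall x, c x p = q.[x].

Definition polynomial_in_du (i : 'I_d) (c : R -> 'rV[R]_d -> R) : Prop :=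
  exists N : nat, forall u p, exists q : {poly R},
    (size q <= N)%N /\ forall x, c u (set_coord p i x) = q.[x].

Record nl_term_ok (t : nl_term) : Prop := {
  nt_affine : (nt_xi t <= 1)%N;
  nt_nonzero : exists u p, nt_coef t u p != 0;
  nt_local : forall (u u' : R) (p p' : 'rV[R]_d),
    (nt_u t = None -> u = u') ->
    (forall i, nt_du t i = None -> p ord0 i = p' ord0 i) ->
    nt_coef t u p = nt_coef t u' p';
  nt_nonpoly_u : nt_u t = None -> ~ polynomial_in_u (nt_coef t);
  nt_nonpoly_du : forall i, nt_du t i = None -> ~ polynomial_in_du i (nt_coef t) }.

(* The finite family of terms [e] is an expression of [F], affine in [xi]. *)
Definition is_expression (F : R -> 'rV[R]_d -> R -> R) (N : nat)
    (e : 'I_N -> nl_term) : Prop :=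
  (forall j, nl_term_ok (e j)) /\
  forall u p xi, F u p xi = \sum_(j < N) nt_eval (e j) u p xi.

Section Subcriticality.
Variables (s : 'I_d -> nat) (alpha beta : R).

Definition dummy_u : bool := beta + alpha <= 0.
Definition dummy_du (i : 'I_d) : bool := beta + alpha <= (s i)%:R.

(* homogeneity of the part of a term in the dummy variables [U] and [P_i] *)
Definition dummy_homogeneity (t : nl_term) : R :=
  (if dummy_u then (beta + alpha) *+ odflt 0%N (nt_u t) else 0)
  + \sum_(i | dummy_du i)
      (beta + alpha - (s i)%:R) *+ odflt 0%N (nt_du t i).

Definition locally_subcritical (N : nat) (e : 'I_N -> nl_term) : Prop :=
  forall j : 'I_N,
  [/\ (* polynomial in the dummy variables *)
      (dummy_u -> nt_u (e j) <> None) /\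
      (forall i, dummy_du i -> nt_du (e j) i <> None),
      (0 < nt_xi (e j))%N ->
        (dummy_u -> nt_u (e j) = Some 0%N) /\
        (forall i, dummy_du i -> nt_du (e j) i = Some 0%N) &
      nt_xi (e j) = 0%N -> alpha < dummy_homogeneity (e j)].

End Subcriticality.

(** * The sets [W_n], [U_n], [P_n^i] *)

Definition le_exp (n : nat) (o : option nat) : bool :=
  if o is Some m then (n <= m)%N else true.

(* the monomial [Xi^m U^n P^k] belongs to [M_F] *)
Definition in_MF (N : nat) (e : 'I_N -> nl_term) (m n : nat) (k : mindex d) : Prop :=
  exists j : 'I_N, [/\ (m <= nt_xi (e j))%N, le_exp n (nt_u (e j)) &
                       forall i, le_exp (k i) (nt_du (e j) i)].

(* [Q(U, P, Xi)] for [Q = Xi^m U^n P^k]; each occurrence of [U], resp. [P_i],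
   may be replaced by a different element *)
Definition subst_monomial (m n : nat) (k : mindex d)
    (U : set (fexpr d)) (P : 'I_d -> set (fexpr d)) : set (fexpr d) :=
  [set t | exists (u : 'I_n -> fexpr d) (p : forall i, 'I_(k i) -> fexpr d),
     [/\ forall j, U (u j), forall i j, P i (p i j) &
         t = fmul (fmul (fpow (fXi d) m) (\big[@fmul d/fone d]_j u j))
               (\big[@fmul d/fone d]_i \big[@fmul d/fone d]_j p i j)]].

(* [{X^k} \cup {I_k(t) : t \in W}] *)
Definition poly_or_int (k : mindex d) (W : set (fexpr d)) : set (fexpr d) :=
  range (@fXpow d) `|` [set v | exists2 t, W t & fI k t = Some v].

Fixpoint WUP (N : nat) (e : 'I_N -> nl_term) (n : nat) :
    set (fexpr d) * set (fexpr d) * ('I_d -> set (fexpr d)) :=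
  if n is n'.+1 then
    let: (W, U, P) := WUP e n' in
    let W' := W `|` [set t | exists m q k,
                       in_MF e m q k /\ subst_monomial m q k U P t] in
    (W', poly_or_int 0 W', fun i => poly_or_int (munit i) W')
  else (set0, set0, fun=> set0).

Definition Wset (N : nat) (e : 'I_N -> nl_term) (n : nat) := (WUP e n).1.1.
Definition Uset (N : nat) (e : 'I_N -> nl_term) (n : nat) := (WUP e n).1.2.

Definition Wall (N : nat) (e : 'I_N -> nl_term) : set (fexpr d) :=
  \bigcup_n Wset e n.

Definition FF (N : nat) (e : 'I_N -> nl_term) : set (fexpr d) :=
  \bigcup_n (Wset e n `|` Uset e n).

End Nonlinearity.

(** * The structure group *)

(* The definitions sealed by [HB.lock] unfold with [unlock]. *)

HB.lock Definition bvec (R : realType) (K : choiceType) (k : K) : malg K R :=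
  mkmalgU k 1.
Arguments bvec R {K} k.

(* linear extension to the free vector space over [K] *)
HB.lock Definition linext (R : realType) (K : choiceType) (V : lmodType R)
    (f : K -> V) (x : malg K R) : V :=
  \sum_(k <- msupp x) mcoeff k x *: f k.

Section Spaces.
Variables (R : realType) (d : nat) (s : 'I_d -> nat) (alpha beta : R).

Local Notation fexpr := (fexpr d).
Local Notation mindex := (mindex d).

Definition Hsp := malg fexpr R.
HB.instance Definition _ := GRing.ComAlgebra.on Hsp.

Definition HI (k : mindex) : Hsp -> Hsp :=
  linext (fun t => oapp (bvec R) 0 (fI k t) : Hsp).

Definition HX (k : mindex) : Hsp := bvec R (fXpow k).

(* the formal expression denoted by [e], or 0 if [e] is excluded *)
Definition eval_expr (e : expr d) : Hsp :=
  oapp (fun a : aexpr d => bvec R (\pi_fexpr a) : Hsp) 0 (insub e).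

(* generators [J_k t] of [H_+] *)
Definition is_Jgen (p : mindex * fexpr) : bool :=
  ~~ fmono p.2 && (0 < fweight s alpha beta p.2 + beta - mweight R s p.1).

(* [inl i] stands for [X_i] and [inr (k, t)] for [J_k t] *)
Definition pgen : choiceType := ('I_d + {p : mindex * fexpr | is_Jgen p})%type.

Definition fplus := cmonom pgen.
HB.instance Definition _ := ConomialDef.on fplus.

Definition Hplus := malg fplus R.
HB.instance Definition _ := GRing.ComAlgebra.on Hplus.

Definition PX (i : 'I_d) : Hplus := bvec R (ucm (inl i : pgen) : fplus).

Definition PXpow (k : mindex) : Hplus := \prod_i PX i ^+ k i.

Definition PXNpow (k : mindex) : Hplus := \prod_i (- PX i) ^+ k i.

Definition PJ (k : mindex) : Hsp -> Hplus :=
  linext (fun t => oapp (fun p => bvec R (ucm (inr p : pgen) : fplus) : Hplus) 0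
                     (insub (k, t))).

End Spaces.

(* [H \otimes H_+] and [H_+ \otimes H_+] are the free [H_+]-modules over the
   bases of [H] and [H_+], the second tensor factor being the coefficient. *)
HB.lock Definition tens (R : realType) (d : nat) (s : 'I_d -> nat)
    (alpha beta : R) (K : choiceType) (x : malg K R) (y : Hplus s alpha beta) :
    malg K (Hplus s alpha beta) :=
  \sum_(k <- msupp x) mkmalgU k (mcoeff k x *: y).

(* [f \otimes phi] *)
HB.lock Definition tmap (R : realType) (d : nat) (s : 'I_d -> nat)
    (alpha beta : R) (K L : choiceType) (f : malg K R -> malg L R)
    (phi : Hplus s alpha beta -> Hplus s alpha beta)
    (z : malg K (Hplus s alpha beta)) : malg L (Hplus s alpha beta) :=
  \sum_(k <- msupp z) tens (f (bvec R k)) (phi (mcoeff k z)).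

(* All but finitely many terms of the sum over [l] and [m] vanish. *)
Fixpoint eDelta (R : realType) (d : nat) (s : 'I_d -> nat) (alpha beta : R)
    (e : expr d) : malg (fexpr d) (Hplus s alpha beta) :=
  match e with
  | EOne => 1
  | EXi => tens (bvec R (fXi d)) 1
  | EX i => tens (bvec R (fX i)) 1 + tens 1 (PX s alpha beta i)
  | EMul a b => eDelta s alpha beta a * eDelta s alpha beta b
  | EI k a =>
      tmap (HI k) id (eDelta s alpha beta a)
      + \sum_(l \in [set: mindex d]) \sum_(m \in [set: mindex d])
          tens ((mfact l)%:R^-1 *: HX R l)
               ((mfact m)%:R^-1 *: PXpow s alpha beta m
                  * PJ s alpha beta (k + l + m) (eval_expr R a))
  end.

HB.lock Definition Delta (R : realType) (d : nat) (s : 'I_d -> nat)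
    (alpha beta : R) (x : Hsp R d) : malg (fexpr d) (Hplus s alpha beta) :=
  \sum_(t <- msupp x) (mcoeff t x)%:A *: eDelta s alpha beta (frepr t).

(* [Delta^+] on the generators of [H_+] *)
HB.lock Definition pgen_Delta (R : realType) (d : nat) (s : 'I_d -> nat)
    (alpha beta : R) (v : pgen s alpha beta) :
    malg (fplus s alpha beta) (Hplus s alpha beta) :=
  match v with
  | inl i => tens (PX s alpha beta i) 1 + tens 1 (PX s alpha beta i)
  | inr p =>
      let: (k, t) := val p in
      \sum_(l \in [set: mindex d])
        tmap (PJ s alpha beta (k + l))
          (fun y => (mfact l)%:R^-1 *: PXNpow s alpha beta l * y)
          (Delta s alpha beta (bvec R t))
      + tens 1 (PJ s alpha beta k (bvec R t))
  end.

HB.lock Definition Deltaplus (R : realType) (d : nat) (s : 'I_d -> nat)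
    (alpha beta : R) (y : Hplus s alpha beta) :
    malg (fplus s alpha beta) (Hplus s alpha beta) :=
  \sum_(m <- msupp y)
    (mcoeff m y)%:A *: \prod_(v <- finsupp m) pgen_Delta v ^+ m v.

Section StructureGroup.
Variables (R : realType) (d : nat) (s : 'I_d -> nat) (alpha beta : R).

Local Notation fexpr := (fexpr d).
Local Notation Hsp := (Hsp R d).
Local Notation Hplus := (Hplus s alpha beta).

(* the set [G], with product [gmul] *)
Definition character (g : Hplus -> R) : Prop := scalar g /\ monoid_morphism g.

Definition gmul (g h : Hplus -> R) (y : Hplus) : R :=
  let z := Deltaplus y in
  \sum_(m <- msupp z) g (bvec R m) * h (mcoeff m z).

(* [Gamma_g = (I \otimes g) Delta] *)
Definition Gamma (g : Hplus -> R) (x : Hsp) : Hsp :=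
  let z := Delta s alpha beta x in
  \sum_(t <- msupp z) mkmalgU t (g (mcoeff t z)).

(** * The regularity structure attached to [F] *)

Variables (N : nat) (e : 'I_N -> nl_term R d).

Definition HF : lmodType R := span_type (bvec R @` FF e : set Hsp).

(* [{a \in H_F | a \in span S}] *)
Definition HFspan (S : set fexpr) : set HF :=
  [set a | lspan (bvec R @` S : set Hsp) (val a)].

Definition AF : set R := fweight s alpha beta @` FF e.

Definition TF (g : R) : set HF :=
  HFspan [set t | FF e t /\ fweight s alpha beta t = g].

Definition TFbar : set HF := HFspan (range (@fXpow d)).

(* the domain of [I] *)
Definition VF : set HF := HFspan (Wall e).

(* [Gam] is the restriction of [Gamma_g] to [H_F] *)
Definition restricts (g : Hplus -> R) (Gam : HF -> HF) : Prop :=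
  forall a, val (Gam a) = Gamma g (val a).

Definition GF : set (HF -> HF) :=
  [set Gam | exists2 g, character g & restricts g Gam].

End StructureGroup.
Arguments TF {R d} s alpha beta {N} e g.
Arguments GF {R d} s alpha beta {N} e.
Arguments TFbar {R d N} e.
Arguments VF {R d N} e.

(* Main.v *)
Require Import Defs.
From HB Require Import structures.
From mathcomp Require Import all_boot all_order all_algebra finmap.
From mathcomp Require Import generic_quotient.
From mathcomp Require Import all_classical all_reals all_analysis.
From mathcomp Require Import lra.
From mathcomp Require Import -(notations) monalg.

Set Implicit Arguments.
Unset Strict Implicit.
Unset Printing Implicit Defensive.

Import Order.TTheory GRing.Theory Num.Theory numFieldNormedType.Exports.
Local Open Scope classical_set_scope.
Local Open Scope quotient_scope.
Local Open Scope ring_scope.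

(* Write [x_i = g(X_i)].  The multinomial formula turns the action of a character
   [g] on an integrated symbol into
     [Gamma_g I_k t = I_k Gamma_g t + sum_n (X + x)^n / n! g(J_{k+n} t)],
   while [Delta^+] gives, with [y_i = h(X_i)],
     [(g h)(J_k t) = sum_l (-y)^l / l! g(J_{k+l} Gamma_h t) + h(J_k t)].
   With these two formulas [Gamma_{g h} = Gamma_g Gamma_h] follows by induction on
   formal expressions, without the coassociativity of [Delta^+].  Instead of an
   antipode, a right inverse of [Gamma_g] is built by recursion on expressions; it
   is again the action of a character.

   Local subcriticality provides [eps > 0] such that [|t| - eps size(t)] is bounded
   below on [F_F]: by [alpha - eps] on the sets [W_n], and by 0 or
   [alpha + beta - |k| - 2 eps], according to its sign, on [U_n] and [P_n].  Bounded
   weight thus forces bounded size; as only [I] and the [I_i] occur in [F_F], this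
   leaves finitely many symbols, and the spaces [T_g] are finite-dimensional. *)

(** * Free vector spaces *)

(** Everything is tested against characters: once [g] is applied to the coefficient factor, tensors
    become vectors of [H], and the coproducts enter only through the two displayed formulas. No
    identity in a triple tensor product is needed. The obstacle is truncation: [J_k t] is 0 unless
    [|t| + beta - |k| > 0], and [I_k], [J_k] vanish on polynomials. A formula obtained on the
    generators of [H_+] must remain true under these conventions. It does, because the action and
    its inverse neither raise weights nor lead out of the polynomials. A right inverse suffices
    because it is given by a character and therefore has a right inverse in turn. In the finiteness
    argument, elements of [W_n] have already given up one [eps], as [Xi] alone does, and each
    integration costs another: this is the origin of [2 eps]. A monomial thus loses at most [2 eps]
    per dummy factor, and the strict inequality against [alpha] in local subcriticality leaves room
    for this loss. *)

Section FreeSpaces.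
Variables (R : realType) (K : choiceType).
Implicit Types (x y : malg K R) (S : set K) (V : lmodType R).

Lemma mcoeff_bvec (k k' : K) : mcoeff k' (bvec R k) = (k == k')%:R.
Proof. by rewrite unlock mcoeffU. Qed.

Lemma mkmalgUE (k : K) (c : R) : mkmalgU k c = c *: bvec R k.
Proof.
apply/malgP => l; rewrite mcoeffZ mcoeff_bvec mcoeffU.
by rewrite -[X in X *+ _]mulr1 -mulrnAr.
Qed.

Lemma malg_bvecE x : x = \sum_(k <- msupp x) mcoeff k x *: bvec R k.
Proof. by rewrite {1}[x]monalgE; apply: eq_bigr => k _; rewrite mkmalgUE. Qed.

Lemma linextEw V (f : K -> V) (D : {fset K}) x :
  (msupp x `<=` D)%fset -> linext f x = \sum_(k <- D) mcoeff k x *: f k.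
Proof.
move=> xD; rewrite unlock (big_fset_incl _ xD) //= => k _ /mcoeff_outdom ->.
by rewrite scale0r.
Qed.

Lemma linext_linear V (f : K -> V) : linear (linext f).
Proof.
move=> c x y; pose D := (msupp x `|` msupp y)%fset.
have xD : (msupp x `<=` D)%fset by exact: fsubsetUl.
have yD : (msupp y `<=` D)%fset by exact: fsubsetUr.
have zD : (msupp (c *: x + y) `<=` D)%fset.
  by apply: fsubset_trans (msuppD_le _ _) _; apply: fsetSU; exact: msuppZ_le.
rewrite !(@linextEw _ _ D) // scaler_sumr -big_split; apply: eq_bigr => k _ /=.
by rewrite mcoeffD mcoeffZ scalerDl scalerA.
Qed.

HB.instance Definition _ V (f : K -> V) :=
  GRing.isLinear.Build R (malg K R) V *:%R (linext f) (linext_linear f).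

Lemma linext_bvec V (f : K -> V) k : linext f (bvec R k) = f k.
Proof.
rewrite (@linextEw _ _ [fset k]%fset) ?big_seq_fset1 ?mcoeff_bvec ?eqxx ?scale1r //.
by rewrite unlock; exact: msuppU_le.
Qed.

Lemma malg_ind (P : malg K R -> Prop) : P 0 ->
  (forall c x k, P x -> P (c *: bvec R k + x)) -> forall x, P x.
Proof.
move=> P0 PD x; rewrite [x]malg_bvecE.
elim: (msupp x : seq K) => [|k r IH]; first by rewrite big_nil.
by rewrite big_cons; exact: PD.
Qed.

End FreeSpaces.

(** * Spans of basis vectors, described by supports *)

Section Support.
Variables (R : realType) (K : choiceType).
Implicit Types (x y : malg K R) (S : set K).

(** Membership in the span of the basis vectors indexed by [S], in a form that needs no explicit
    coefficients; [lspan_bvecP] is the equivalence with [lspan]. *)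
Definition supp_in S x : Prop := forall k, mcoeff k x != 0 -> S k.

Lemma supp_inW S S' x : S `<=` S' -> supp_in S x -> supp_in S' x.
Proof. by move=> SS' Sx k /Sx /SS'. Qed.

Lemma supp_in_bvec S k : S k -> supp_in S (bvec R k).
Proof. by move=> Sk l; rewrite mcoeff_bvec; case: (eqVneq k l) => [<-|_] //; rewrite eqxx. Qed.

Lemma supp_in0 S : supp_in S (0 : malg K R).
Proof. by move=> k; rewrite mcoeff0 eqxx. Qed.

Lemma supp_inD S x y : supp_in S x -> supp_in S y -> supp_in S (x + y).
Proof.
move=> Sx Sy k; rewrite mcoeffD; have [->|/Sx//] := eqVneq (mcoeff k x) 0.
by rewrite add0r => /Sy.
Qed.

Lemma supp_inZ S c x : supp_in S x -> supp_in S (c *: x).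
Proof. by move=> Sx k; rewrite mcoeffZ mulf_eq0 negb_or => /andP[_ /Sx]. Qed.

Lemma supp_inN S x : supp_in S x -> supp_in S (- x).
Proof. by move=> Sx; rewrite -scaleN1r; exact: supp_inZ. Qed.

Lemma supp_in_sum S (I : eqType) (r : seq I) (P : pred I) (F : I -> malg K R) :
  (forall i, i \in r -> P i -> supp_in S (F i)) ->
  supp_in S (\sum_(i <- r | P i) F i).
Proof.
move=> SF; rewrite big_seq_cond; apply: big_ind => [|x y|i /andP[]].
- exact: supp_in0.
- exact: supp_inD.
- exact: SF.
Qed.

Lemma supp_in_linext (L : choiceType) (S' : set L) (f : L -> malg K R) S
    (x : malg L R) :
  (forall k, S' k -> supp_in S (f k)) -> (forall k, mcoeff k x != 0 -> S' k) ->
  supp_in S (linext f x).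
Proof.
move=> Sf S'x; rewrite unlock; apply: supp_in_sum => k + _.
by rewrite -mcoeff_neq0 => /S'x /Sf; exact: supp_inZ.
Qed.

Lemma linear_supp0 (V : lmodType R) (f : {linear malg K R -> V}) S x :
  (forall k, S k -> f (bvec R k) = 0) -> supp_in S x -> f x = 0.
Proof.
move=> f0 Sx; rewrite [x]malg_bvecE linear_sum big_seq big1 // => k kx.
by rewrite linearZ_LR f0 ?scaler0 //; apply: Sx; rewrite mcoeff_neq0.
Qed.

Lemma lspan_bvecP S x : lspan (bvec R @` S) x <-> supp_in S x.
Proof.
split=> [[n [c [v [Sv ->]]]]|Sx].
  apply: supp_in_sum => i _ _; apply: supp_inZ; have [k Sk <-] := Sv i.
  exact: supp_in_bvec.
exists (size (msupp x)), (fun i => mcoeff (tnth (in_tuple (msupp x)) i) x).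
exists (fun i => bvec R (tnth (in_tuple (msupp x)) i)); split=> [i|].
  by exists (tnth (in_tuple (msupp x)) i) => //; apply: Sx;
    rewrite mcoeff_neq0; exact: mem_tnth.
by rewrite {1}[x]malg_bvecE big_tnth.
Qed.

End Support.

Lemma supp_inM (R : realType) (K : conomType) (S S' S'' : set K)
    (x y : malg K R) :
  (forall k l, S k -> S' l -> S'' (monalg.mul k l)) ->
  supp_in S x -> supp_in S' y -> supp_in S'' (x * y).
Proof.
move=> SM Sx Sy k; rewrite mcoeff_neq0 => /msuppM_le[a [b [ax by_ ->]]].
by apply: SM; [apply: Sx|apply: Sy]; rewrite mcoeff_neq0.
Qed.

Lemma bvecM (R : realType) (K : conomType) (k l : K) :
  bvec R (monalg.mul k l) = bvec R k * bvec R l.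
Proof. by rewrite unlock malgM_def fgmulUU mulr1. Qed.

Lemma bvec1 (R : realType) (K : conomType) : bvec R (monalg.one : K) = 1.
Proof. by rewrite unlock. Qed.

Section LinearExtensionMorphism.
Variables (R : realType) (K : conomType) (A : comAlgType R).

Lemma linextM (f : K -> A) :
  (forall k l, f (monalg.mul k l) = f k * f l) ->
  forall x y, linext f (x * y) = linext f x * linext f y.
Proof.
move=> fM x y; elim/malg_ind: x => [|c x k IHx]; first by rewrite !(mul0r, linear0).
rewrite mulrDl !linearD /= IHx mulrDl; congr (_ + _).
rewrite -scalerAl !linearZ /= -scalerAl; congr (_ *: _).
rewrite linext_bvec; elim/malg_ind: y {IHx} => [|b y l IHy].
  by rewrite !(mulr0, linear0).
rewrite mulrDr !linearD /= IHy mulrDr -scalerAr !linearZ /= -scalerAr.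
by rewrite -bvecM !linext_bvec fM.
Qed.

End LinearExtensionMorphism.

(** * Characters *)

Section Characters.
Variables (R : realType) (d : nat) (s : 'I_d -> nat) (alpha beta : R).
Local Notation Hplus := (Hplus s alpha beta).
Local Notation pgen := (pgen s alpha beta).
Local Notation fplus := (fplus s alpha beta).
Implicit Types g h : Hplus -> R.

(** Bundles a character as a linear map into [R^o], so that the theory of linear maps applies; the
    equality of functions allows rewriting where only a bare functional appears. *)
Lemma charP g : character g ->
  exists g' : {linear Hplus -> R^o}, g = g' /\ monoid_morphism g'.
Proof.
move=> [gl gm].
pose g' : {linear Hplus -> R^o} :=
  HB.pack g (GRing.isLinear.Build R Hplus R^o *:%R g gl).
by exists g'.
Qed.

(** [H_+] is the free commutative algebra on [pgen], so arbitrary values on the generators extend to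
    a character. Products and inverses of characters are obtained in this form. *)
Definition char_of (w : pgen -> R) : Hplus -> R :=
  linext (fun m : fplus => \prod_(v <- finsupp m) w v ^+ m v : R^o).

Lemma char_of_gen w v : char_of w (bvec R (ucm v : fplus)) = w v.
Proof. by rewrite /char_of linext_bvec mdomU big_seq_fset1 ucmE eqxx expr1. Qed.

Lemma char_of_character w : character (char_of w).
Proof.
split; first exact: linext_linear.
split.
  rewrite /char_of -(bvec1 R fplus) linext_bvec big1_seq // => v.
  by rewrite mdom1.
apply: linextM => m n.
have prodE (D : {fset pgen}) (l : fplus) : (finsupp l `<=` D)%fset ->
    \prod_(v <- finsupp l) w v ^+ l v = \prod_(v <- D) w v ^+ l v.
  move=> lD; apply: big_fset_incl => // v _.
  by rewrite -cmE_eq0 => /eqP ->; rewrite expr0.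
pose D := (finsupp m `|` finsupp n)%fset.
rewrite !(prodE D) ?fsubsetUl ?fsubsetUr // ?mdomD //.
rewrite -big_split /=; apply: eq_bigr => v _; by rewrite cmM exprD.
Qed.

End Characters.

(** * Evaluation of the second tensor factor *)

Section Evaluation.
Variables (R : realType) (d : nat) (s : 'I_d -> nat) (alpha beta : R).
Local Notation Hplus := (Hplus s alpha beta).
Variables (g : {linear Hplus -> R^o}).

Lemma charX (p : Hplus) n : monoid_morphism g -> g (p ^+ n) = g p ^+ n.
Proof.
move=> [g1 gM]; elim: n => [|n IHn]; first by rewrite !expr0 g1.
by rewrite !exprS gM IHn.
Qed.

Lemma char_prod (I : Type) (r : seq I) (F : I -> Hplus) : monoid_morphism g ->
  g (\prod_(i <- r) F i) = \prod_(i <- r) g (F i).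
Proof. by move=> [g1 gM]; exact: (big_morph g gM g1). Qed.

Section OneSpace.
Variable K : choiceType.
Implicit Types z : malg K Hplus.

(* [I \otimes g] *)
Definition ev z : malg K R := \sum_(t <- msupp z) mkmalgU t (g (mcoeff t z)).

Lemma mcoeff_ev k z : mcoeff k (ev z) = g (mcoeff k z).
Proof.
rewrite /ev raddf_sum /=.
have [kz|kz] := boolP (k \in msupp z).
  rewrite (big_fsetD1 k) //= mcoeffUU big_seq big1 ?addr0 // => l.
  by rewrite in_fsetD1 mcoeffU => /andP[/negbTE ->].
rewrite (mcoeff_outdom kz) linear0 big_seq big1 // => l lz.
by rewrite mcoeffU; case: eqP kz => // <-; rewrite lz.
Qed.

Lemma ev_is_additive : additive ev.
Proof. by move=> x y; apply/malgP => k; rewrite !(mcoeffB, mcoeff_ev) linearB. Qed.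

HB.instance Definition _ :=
  GRing.isAdditive.Build (malg K Hplus) (malg K R) ev ev_is_additive.

Lemma evD y z : ev (y + z) = ev y + ev z.
Proof. exact: raddfD. Qed.

Lemma ev_sum (I : Type) (r : seq I) (F : I -> malg K Hplus) :
  ev (\sum_(i <- r) F i) = \sum_(i <- r) ev (F i).
Proof. exact: raddf_sum. Qed.

Lemma ev_tens (x : malg K R) (y : Hplus) : ev (tens x y) = g y *: x.
Proof.
rewrite unlock raddf_sum [in RHS](malg_bvecE x) scaler_sumr; apply: eq_bigr => k _.
apply/malgP => l; rewrite mcoeff_ev !mcoeffZ mcoeff_bvec mcoeffU.
rewrite [LHS](raddfMn g) [X in X *+ _](linearZ_LR g) mulrA mulr_natr.
by congr (_ *+ _); rewrite mulrC.
Qed.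

Lemma evZ (c : R) z : ev (c%:A *: z) = c *: ev z.
Proof.
apply/malgP => u; rewrite mcoeff_ev !mcoeffZ mcoeff_ev mulr_algl.
exact: linearZ_LR.
Qed.

End OneSpace.

(** The hypothesis on [phi] covers both uses: the identity in [Delta], and multiplication by
    [(-X)^l / l!] in [Delta^+], which a character turns into a scalar. *)
Lemma ev_tmap (K L : choiceType) (f : {linear malg K R -> malg L R})
    (phi : Hplus -> Hplus) (c : R) (z : malg K Hplus) :
  (forall y, g (phi y) = c * g y) -> ev (tmap f phi z) = c *: f (ev z).
Proof.
move=> gphi; rewrite unlock raddf_sum /= [ev z]/ev linear_sum scaler_sumr /=.
apply: eq_bigr => k _.
by rewrite ev_tens gphi mkmalgUE linearZ scalerA.
Qed.

Lemma evM (K : conomType) (x y : malg K Hplus) : monoid_morphism g ->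
  ev (x * y) = ev x * ev y.
Proof.
move=> [_ gM]; apply/malgP => k; rewrite mcoeff_ev.
(* Evaluation may kill coefficients, so both products are expanded over the supports before
   evaluation. *)
have suppE (z : malg K Hplus) : (msupp (ev z) `<=` msupp z)%fset.
  apply/fsubsetP => l; rewrite -!mcoeff_neq0 mcoeff_ev.
  by apply: contra_neq => ->; rewrite linear0.
rewrite (mcoeffMlw _ (suppE x) (suppE y)) mcoeffMl linear_sum; apply: eq_bigr => i _.
rewrite linear_sum; apply: eq_bigr => j _.
have gMn y' n : g (y' *+ n) = g y' *+ n by exact: raddfMn.
by rewrite !mcoeff_ev gMn gM.
Qed.

Lemma ev1 (K : conomType) : monoid_morphism g -> ev (1 : malg K Hplus) = 1.
Proof.
move=> [g1 _]; apply/malgP => k; rewrite mcoeff_ev !mcoeff1.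
by case: eqP; rewrite ?linear0 ?g1.
Qed.

End Evaluation.

(** * Sums over multiindices *)

Section Multiindices.
Variable d : nat.
Implicit Types k l m n : mindex d.

(** Boxes serve as explicit finite ranges for the sums over all multiindices; if [k + l] lies in a
    box, so do [k] and [l]. *)
Definition mbox (B : nat) : seq (mindex d) :=
  [seq [ffun i => (f i : nat)] | f : {ffun 'I_d -> 'I_B.+1}].

Lemma mem_mbox B k : (k \in mbox B) = [forall i, (k i <= B)%N].
Proof.
apply/idP/forallP => [/mapP[f _ ->] i|kB]; first by rewrite ffunE -ltnS.
apply/mapP; exists [ffun i => inord (k i)]; first by rewrite mem_enum.
by apply/ffunP => i; rewrite !ffunE inordK // ltnS.
Qed.

Lemma mbox_uniq B : uniq (mbox B).
Proof.
rewrite map_inj_uniq ?enum_uniq // => f g /ffunP fg.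
by apply/ffunP => i; have := fg i; rewrite !ffunE => /val_inj.
Qed.

Lemma mboxS B B' k : (B <= B')%N -> k \in mbox B -> k \in mbox B'.
Proof.
rewrite !mem_mbox => BB' /forallP kB; apply/forallP => i.
exact: leq_trans (kB i) BB'.
Qed.

Definition msub n l : mindex d := [ffun i => (n i - l i)%N].

Lemma mbox_addl B k l : (k + l) \in mbox B -> k \in mbox B.
Proof.
rewrite !mem_mbox => /forallP kB; apply/forallP => i.
by apply: leq_trans (kB i); rewrite ffunE leq_addr.
Qed.

Lemma mbox_addr B k l : (k + l) \in mbox B -> l \in mbox B.
Proof. by rewrite addrC; exact: mbox_addl. Qed.

Lemma fsbig_mbox (V : nmodType) (F : mindex d -> V) B :
  (forall k, k \notin mbox B -> F k = 0) ->
  \sum_(k \in [set: mindex d]) F k = \sum_(k <- mbox B) F k.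
Proof.
move=> F0; rewrite (fsbigE (mbox B)) //; last by move=> k _; exact: F0.
  by apply: eq_bigl => k; rewrite in_setT.
exact: mbox_uniq.
Qed.

(** * Exponential terms and the multinomial formula *)

Section Exponential.
Variables (R : realType) (A : comAlgType R).
Implicit Types z w : 'I_d -> A.

(** The term [z^n / n!] of the exponential series: with this normalization the binomial formula has
    no coefficients. *)
Definition mexp n z : A := (mfact n)%:R^-1 *: \prod_i z i ^+ n i.

Lemma mexpE n z : mexp n z = \prod_i ((n i)`!%:R^-1 *: z i ^+ n i).
Proof.
rewrite /mexp /mfact natr_prod -prodfV.
elim/big_rec3: _ => [|i a b c _ <-]; first by rewrite scale1r.
by rewrite -scalerAl -scalerAr scalerA.
Qed.

(** The range of [j] is padded with zeros up to [B] so that all coordinates share one index type, as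
    distributing a product over sums requires. *)
Lemma exp_binomial (a b : A) N B : (N <= B)%N ->
  N`!%:R^-1 *: (a + b) ^+ N =
  \sum_(j < B.+1) if (j <= N)%N
    then (j`!%:R^-1 *: a ^+ j) * ((N - j)`!%:R^-1 *: b ^+ (N - j)) else 0.
Proof.
move=> NB; rewrite addrC exprDn scaler_sumr -big_mkcond /=.
pose G j : A := (j`!%:R^-1 *: a ^+ j) * ((N - j)`!%:R^-1 *: b ^+ (N - j)).
transitivity (\sum_(j < N.+1) G j); last first.
  by rewrite (big_ord_widen_cond B.+1 xpredT G) //; apply: eq_bigl => j; rewrite ltnS.
apply: eq_bigr => j _; have jN : (j <= N)%N by rewrite -ltnS.
rewrite /G -[RHS]scalerAl [X in _ = _ *: X]mulrC -[X in _ = _ *: X]scalerAl !scalerA.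
rewrite -[X in _ *: X = _]scaler_nat scalerA; congr (_ *: _).
have fact_neq0 (q : nat) : (q`!%:R : R) != 0 by rewrite pnatr_eq0 -lt0n fact_gt0.
apply: (mulfI (fact_neq0 N)); rewrite mulrA mulfV // mul1r -(bin_fact jN) !natrM.
by rewrite -mulrA mulrACA !mulfV // mulr1 mulr1.
Qed.

Lemma mexpD n z w B : n \in mbox B ->
  mexp n (fun i => z i + w i) =
  \sum_(l <- mbox B | [forall i, (l i <= n i)%N]) mexp l z * mexp (msub n l) w.
Proof.
rewrite mem_mbox => /forallP nB; rewrite mexpE.
under eq_bigr => i _ do rewrite (exp_binomial _ _ (nB i)).
(* Distributivity produces a sum over functions from coordinates to [0..B], which are the elements
   of the box. *)
rewrite bigA_distr_bigA /= [RHS]big_mkcond /mbox big_image /=; apply: eq_bigr => f _.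
case: ifPn => [/forallP fn|/forallPn[i fi]].
  rewrite !mexpE -big_split; apply: eq_bigr => i _ /=.
  by have := fn i; rewrite !ffunE => ->.
by move: fi; rewrite (bigD1 i) //= ffunE => /negbTE ->; rewrite mul0r.
Qed.

(* The multinomial formula, read against a sequence of coefficients. *)
Lemma sum_mexpD z w (c : mindex d -> A) B :
  (forall n, n \notin mbox B -> c n = 0) ->
  \sum_(l <- mbox B) \sum_(m <- mbox B) mexp l z * mexp m w * c (l + m) =
  \sum_(n <- mbox B) mexp n (fun i => z i + w i) * c n.
Proof.
move=> c0.
under [RHS]eq_big_seq => n nB do rewrite (mexpD _ _ nB) mulr_suml.
under [RHS]eq_bigr => n _ do rewrite big_mkcond.
rewrite [RHS]exchange_big /=; apply: eq_big_seq => l lB.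
rewrite -[RHS]big_mkcond /=.
rewrite [LHS](bigID (fun m => l + m \in mbox B)) /= [X in _ + X]big1 ?addr0; last first.
  by move=> m /c0 ->; rewrite mulr0.
rewrite -[LHS]big_filter -[RHS]big_filter.
have addlK m : msub (l + m) l = m by apply/ffunP => i; rewrite !ffunE addKn.
(* For fixed [l], the map [m |-> l + m] is a bijection onto the [n >= l] of the box. *)
rewrite [RHS](perm_big [seq l + m | m <- mbox B & l + m \in mbox B]) /=.
  by rewrite big_map; apply: eq_bigr => m _; rewrite addlK.
rewrite perm_sym; apply: uniq_perm.
- by rewrite map_inj_uniq ?filter_uniq ?mbox_uniq //; by move=> m m' /(congr1 (msub^~ l)); rewrite !addlK.
- by rewrite filter_uniq ?mbox_uniq.
move=> n; apply/mapP/idP => [[m + ->]|].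
  rewrite !mem_filter => /andP[-> _]; rewrite andbT.
  by apply/forallP => i; rewrite ffunE leq_addr.
rewrite mem_filter => /andP[/forallP ln nB].
have nE : n = l + msub n l by apply/ffunP => i; rewrite !ffunE; apply/esym/subnKC.
by exists (msub n l) => //; rewrite mem_filter -nE nB; apply: (@mbox_addr _ l); rewrite -nE.
Qed.

End Exponential.
End Multiindices.

(** * Formal expressions *)

Section FormalExpressions.
Variable d : nat.
Local Notation fexpr := (fexpr d).
Local Notation expr := (expr d).
Implicit Types (a b : expr) (t u v : fexpr) (k l m : mindex d).

Lemma is_mono_eqv a b : eqv a b -> is_mono a = is_mono b.
Proof.
elim=> //= [? ? ? _ -> _ //|? ?|? ? ?|? ? ? ? _ -> _ -> //].
- exact: andbC.
- exact: andbA.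
Qed.

Lemma admissible_eqv a b : eqv a b -> admissible a = admissible b.
Proof.
elim=> //= [? ? ? _ -> _ //|? ?|? ? ?|? ? ? ? _ -> _ -> //|_ a' b' ab ->].
- exact: andbC.
- exact: andbA.
- by rewrite (is_mono_eqv ab).
Qed.

Lemma fmonoM t u : fmono (fmul t u) = fmono t && fmono u.
Proof. by rewrite /fmono (is_mono_eqv (frepr_mul t u)). Qed.

Lemma fmono_fX i : fmono (fX i : fexpr).
Proof. by rewrite /fmono (is_mono_eqv (frepr_pi _)). Qed.

Lemma fmono_fone : fmono (fone d).
Proof. by rewrite /fmono (is_mono_eqv (frepr_pi _)). Qed.

Lemma fmono_fXpow k : fmono (fXpow k : fexpr).
Proof.
rewrite /fXpow; elim/big_ind: _ => [|t u tm um|i _]; first exact: fmono_fone.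
- by rewrite fmonoM tm.
- by elim: (k i) => [|n IHn]; [exact: fmono_fone|rewrite /= fmonoM fmono_fX].
Qed.

Lemma fI_mono k t : fmono t -> fI k t = None.
Proof. by rewrite /fmono /fI => tm; rewrite insubN //= tm andbF. Qed.

Lemma fI_eqv k t v : fI k t = Some v -> eqv (frepr v) (EI k (frepr t)).
Proof.
rewrite /fI; case: insubP => //= a _ aE [<-]; rewrite -aE; exact: frepr_pi.
Qed.

Lemma fI_some k t : ~~ fmono t -> exists v, fI k t = Some v.
Proof.
rewrite /fmono /fI => tm; case: insubP => [a _ _|/=]; first by exists (\pi_fexpr a).
by rewrite frepr_adm tm.
Qed.

(** Structural induction for classes. The recursion runs on a raw admissible expression and speaks
    of every class that it represents, because [frepr] commutes with the constructors only up to
    [eqv]. *)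
Lemma fexpr_ind (P : fexpr -> Prop) :
  P (fone d) -> P (fXi d) -> (forall i, P (fX i)) ->
  (forall t u, P t -> P u -> P (fmul t u)) ->
  (forall k t v, fI k t = Some v -> P t -> P v) -> forall t, P t.
Proof.
move=> P1 PXi PX PM PI t.
suff Pe a : admissible a -> forall u, eqv (frepr u) a -> P u.
  exact: Pe (frepr_adm t) t (eqv_refl _).
elim: a => [_ u|_ u|i _ u|a IHa b IHb /= /andP[aa ab] u|k a IHa /= /andP[aa am] u].
- move=> uE; have /fexpr_eqP -> := eqv_trans uE (eqv_sym (frepr_pi (@AExpr d (EOne d) erefl))).
  exact: P1.
- move=> uE; have /fexpr_eqP -> := eqv_trans uE (eqv_sym (frepr_pi (@AExpr d (EXi d) erefl))).
  exact: PXi.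
- move=> uE; have /fexpr_eqP -> := eqv_trans uE (eqv_sym (frepr_pi (@AExpr d (EX i) erefl))).
  exact: PX.
- pose ta := \pi_fexpr (AExpr aa); pose tb := \pi_fexpr (AExpr ab) => uE.
  have -> : u = fmul ta tb.
    apply/fexpr_eqP; apply: eqv_trans uE _; apply: eqv_sym.
    apply: eqv_trans (frepr_mul _ _) _.
    exact: eqv_mul (frepr_pi (AExpr aa)) (frepr_pi (AExpr ab)).
  by apply: PM; [apply: IHa => //|apply: IHb => //]; exact: frepr_pi.
- pose ta := \pi_fexpr (AExpr aa) => uE.
  have taE : eqv (frepr ta) a by exact: frepr_pi.
  have [v tav] : exists v, fI k ta = Some v.
    by apply: fI_some; rewrite /fmono (is_mono_eqv taE).
  have -> : u = v.
    apply/fexpr_eqP; apply: eqv_trans uE _; apply: eqv_sym.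
    by apply: eqv_trans (fI_eqv tav) _; exact: eqv_int.
  by apply: PI tav _; exact: IHa.
Qed.

Section Weight.
Variables (R : realType) (s : 'I_d -> nat) (alpha beta : R).
Local Notation wt := (fweight s alpha beta).

Lemma eweight_eqv a b : eqv a b -> eweight s alpha beta a = eweight s alpha beta b.
Proof.
elim=> //= [? ? ? _ -> _ //|? ?|? ? ?|?|? ? ? ? _ -> _ -> //|? ? ? _ -> //].
- exact: addrC.
- exact: addrA.
- exact: add0r.
Qed.

Lemma fweight1 : wt (fone d) = 0.
Proof. by rewrite /fweight (eweight_eqv (frepr_pi _)). Qed.

Lemma fweightXi : wt (fXi d) = alpha.
Proof. by rewrite /fweight (eweight_eqv (frepr_pi _)). Qed.

Lemma fweightX i : wt (fX i) = (s i)%:R.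
Proof. by rewrite /fweight (eweight_eqv (frepr_pi _)). Qed.

Lemma fweightM t u : wt (fmul t u) = wt t + wt u.
Proof. by rewrite /fweight (eweight_eqv (frepr_mul t u)). Qed.

Lemma fweightI k t v : fI k t = Some v -> wt v = wt t + beta - Defs.mweight R s k.
Proof. by move=> /fI_eqv tv; rewrite /fweight (eweight_eqv tv). Qed.

Lemma mweight0 : Defs.mweight R s 0 = 0.
Proof. by rewrite /Defs.mweight big1 // => i _; rewrite ffunE muln0. Qed.

Lemma mweightD k l : Defs.mweight R s (k + l) = Defs.mweight R s k + Defs.mweight R s l.
Proof.
rewrite /Defs.mweight -natrD -big_split; congr (_%:R); apply: eq_bigr => i _.
by rewrite ffunE mulnDr.
Qed.

Lemma mweight_munit i : Defs.mweight R s (munit i) = (s i)%:R.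
Proof.
rewrite /Defs.mweight (bigD1 i) //= ffunE eqxx muln1 big1 ?addn0 // => j /negbTE ji.
by rewrite ffunE eq_sym ji muln0.
Qed.

Lemma mweight_ge0 k : 0 <= Defs.mweight R s k.
Proof. exact: ler0n. Qed.

Lemma mweight_gt (B : nat) k : is_scaling s -> k \notin mbox d B -> B%:R < Defs.mweight R s k.
Proof.
move=> [s_gt0 _]; rewrite mem_mbox => /forallPn[i]; rewrite -ltnNge => Bk.
rewrite ltr_nat (bigD1 i) //=; apply: (leq_trans Bk); apply: leq_trans (leq_addr _ _).
by rewrite leq_pmull.
Qed.

End Weight.

Section Operators.
Variables (R : realType) (s : 'I_d -> nat) (alpha beta : R).
Local Notation Hsp := (Hsp R d).
Local Notation wt := (fweight s alpha beta).
Local Notation PJ := (PJ s alpha beta).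

HB.instance Definition _ k := GRing.Linear.copy (@HI R d k) (linext _).
HB.instance Definition _ k :=
  GRing.Linear.copy (@Defs.PJ R d s alpha beta k) (linext _).

Lemma HI_bvec k t v : fI k t = Some v -> HI k (bvec R t) = bvec R v.
Proof. by rewrite /HI linext_bvec => ->. Qed.

Lemma HI_mono k t : fmono t -> HI k (bvec R t) = 0.
Proof. by rewrite /HI linext_bvec => /fI_mono ->. Qed.

Lemma PJ_eq0 k t : ~~ is_Jgen s alpha beta (k, t) -> PJ k (bvec R t) = 0.
Proof. by rewrite /Defs.PJ linext_bvec => kt; rewrite insubN. Qed.

Lemma PJ_gen k t (kt : is_Jgen s alpha beta (k, t)) :
  PJ k (bvec R t) =
  bvec R (ucm (inr (exist _ (k, t) kt) : pgen s alpha beta) : fplus s alpha beta).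
Proof. by rewrite /Defs.PJ linext_bvec (insubT (is_Jgen s alpha beta) kt). Qed.

(** [J_k t] vanishes once [|k| >= |t| + beta], and outside a box of side [B] the weight exceeds [B]
    since every [s i] is at least 1. This is why all sums over multiindices are finite. *)
Lemma PJ_bound (x : Hsp) : is_scaling s ->
  exists B, forall k, k \notin mbox d B -> PJ k x = 0.
Proof.
move=> ss; elim/malg_ind: x => [|c x t [B xB]].
  by exists 0%N => k _; rewrite linear0.
pose B' := Num.bound `|wt t + beta|; exists (maxn B B') => k kB.
have kB1 : k \notin mbox d B by apply: contra kB; apply: mboxS; exact: leq_maxl.
have kB2 : k \notin mbox d B' by apply: contra kB; apply: mboxS; exact: leq_maxr.
have -> : PJ k (c *: bvec R t + x) = c *: PJ k (bvec R t) + PJ k x by exact: linearP.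
rewrite xB // addr0 PJ_eq0 ?scaler0 // /is_Jgen negb_and -leNgt /=.
apply/orP; right; rewrite subr_le0 (le_trans _ (ltW (mweight_gt R ss kB2))) //.
by apply: le_trans (ler_norm _) _; exact: ltW (archi_boundP (normr_ge0 _)).
Qed.

Lemma PJ_bound2 (x y : Hsp) : is_scaling s ->
  exists B, (forall k, k \notin mbox d B -> PJ k x = 0) /\
            (forall k, k \notin mbox d B -> PJ k y = 0).
Proof.
move=> ss; have [B xB] := PJ_bound x ss; have [B' yB] := PJ_bound y ss.
exists (maxn B B'); split=> k kB.
  by apply: xB; apply: contra kB; apply: mboxS; exact: leq_maxl.
by apply: yB; apply: contra kB; apply: mboxS; exact: leq_maxr.
Qed.

Definition Xvar (i : 'I_d) : Hsp := bvec R (fX i).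

Lemma bvec_fmul t u : bvec R (fmul t u) = bvec R t * bvec R u :> Hsp.
Proof. exact: (bvecM R t u). Qed.

Lemma bvec_fone : bvec R (fone d) = 1 :> Hsp.
Proof. exact: (bvec1 R fexpr). Qed.

Lemma bvec_fprod (I : Type) (r : seq I) (F : I -> fexpr) :
  bvec R (\big[@fmul d/fone d]_(i <- r) F i) = \prod_(i <- r) bvec R (F i) :> Hsp.
Proof.
elim: r => [|i r IHr]; first by rewrite !big_nil bvec_fone.
by rewrite !big_cons bvec_fmul IHr.
Qed.

Lemma bvec_fpow t n : bvec R (fpow t n) = bvec R t ^+ n :> Hsp.
Proof.
by elim: n => [|n IHn]; rewrite ?bvec_fone ?expr0 //= bvec_fmul IHn exprS.
Qed.

Lemma HXE k : HX R k = \prod_i Xvar i ^+ k i.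
Proof. by rewrite /HX /fXpow bvec_fprod; apply: eq_bigr => i _; rewrite bvec_fpow. Qed.

Lemma eval_expr_frepr t : eval_expr R (frepr t) = bvec R t.
Proof. by rewrite /eval_expr /frepr valK /= reprK. Qed.

Lemma eval_expr_eqv a b : eqv a b -> eval_expr R a = eval_expr R b.
Proof.
move=> ab; rewrite /eval_expr; case: insubP => [a' _ aE|]; last first.
  by rewrite (admissible_eqv ab) => nb; rewrite insubN.
case: insubP => [b' _ bE|]; last by rewrite -(admissible_eqv ab) -aE (valP a').
congr (bvec R _); apply/eqquotP/asboolP; by rewrite aE bE.
Qed.

End Operators.
End FormalExpressions.

(** * The action of a character *)

Section Exponentials.
Variables (R : realType) (d : nat) (A : comAlgType R).

Lemma mexp_alg (n : mindex d) (x : 'I_d -> R) :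
  mexp n (fun i => (x i)%:A : A) = ((mfact n)%:R^-1 * \prod_i x i ^+ n i)%:A.
Proof.
rewrite /mexp -scalerA; congr (_ *: _).
rewrite -[RHS]/(in_alg A _) rmorph_prod; apply: eq_bigr => i _.
by rewrite rmorphXn.
Qed.

Lemma scaler_mul_alg (p q : R) (u : A) : (p * q) *: u = u * p%:A * q%:A.
Proof. by rewrite !mulr_algr scalerA mulrC. Qed.

End Exponentials.

Section Action.
Variables (R : realType) (d : nat) (s : 'I_d -> nat) (alpha beta : R).
Hypothesis ss : is_scaling s.
Local Notation Hplus := (Hplus s alpha beta).
Local Notation Hsp := (Hsp R d).
Local Notation PJ := (PJ s alpha beta).
Local Notation PX := (PX s alpha beta).
Local Notation X := (Xvar R (d := d)).
Variable g : {linear Hplus -> R^o}.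
Hypothesis gm : monoid_morphism g.

Lemma char_PXpow n : g (PXpow s alpha beta n) = \prod_i g (PX i) ^+ n i.
Proof.
by rewrite /PXpow char_prod //; apply: eq_bigr => i _; exact: charX.
Qed.

(** The action on raw expressions, where [Delta] is defined by recursion; [eG_eqv] lets it descend
    to classes. *)
Definition eG (a : expr d) : Hsp := ev g (eDelta s alpha beta a).

(* [sum_n (X + g(X))^n / n! g(J_{k+n} x)]: by the multinomial formula, this is
   the polynomial added by [Gamma g] to [I_k (Gamma g x)]. *)
Definition Gpoly (k : mindex d) (x : Hsp) : Hsp :=
  \sum_(n \in [set: mindex d])
    g (PJ (k + n) x) *: mexp n (fun i => X i + (g (PX i))%:A : Hsp).

Lemma GpolyE k x B : (forall l, l \notin mbox d B -> PJ l x = 0) ->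
  Gpoly k x = \sum_(n <- mbox d B)
    g (PJ (k + n) x) *: mexp n (fun i => X i + (g (PX i))%:A : Hsp).
Proof.
move=> xB; apply: fsbig_mbox => n nB.
by rewrite xB ?linear0 ?scale0r //; apply: contra nB; exact: mbox_addr.
Qed.

Lemma tens0r (K : choiceType) (x : malg K R) : tens x (0 : Hplus) = 0.
Proof. by rewrite unlock big1 // => k _; rewrite scaler0 monalgU0. Qed.

Lemma eG1 : eG (EOne d) = 1.
Proof. exact: ev1. Qed.

Lemma eGM a b : eG (EMul a b) = eG a * eG b.
Proof. exact: evM. Qed.

Lemma eGXi : eG (EXi d) = bvec R (fXi d).
Proof. by rewrite /eG /= ev_tens; have [-> _] := gm; rewrite scale1r. Qed.

Lemma eGX i : eG (EX i) = X i + (g (PX i))%:A.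
Proof.
by rewrite /eG /= raddfD /= !ev_tens; have [-> _] := gm; rewrite scale1r.
Qed.

Lemma eGI k a : eG (EI k a) = HI k (eG a) + Gpoly k (eval_expr R a).
Proof.
rewrite /eG /= raddfD /=; congr (_ + _).
  by rewrite (@ev_tmap _ _ _ _ _ g _ _ (HI k) id 1) ?scale1r // => y; rewrite mul1r.
have [B xB] := PJ_bound alpha beta (eval_expr R a) ss.
rewrite (GpolyE _ xB).
under eq_fsbigr => l _.
  rewrite (@fsbig_mbox _ _ _ B); first over.
  move=> m mB; rewrite xB ?mulr0 ?tens0r //.
  by apply: contra mB; exact: mbox_addr.
rewrite (@fsbig_mbox _ _ _ B); last first.
  move=> l lB; apply: big1 => m _; rewrite xB ?mulr0 ?tens0r //.
  by apply: contra lB => /mbox_addl; exact: mbox_addr.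
rewrite raddf_sum /=.
transitivity (\sum_(n <- mbox d B) mexp n (fun i => X i + (g (PX i))%:A : Hsp)
   * (g (PJ (k + n) (eval_expr R a)))%:A); last first.
  by apply: eq_bigr => n _; rewrite mulr_algr.
(* The double sum over [l] and [m] depends on [J] only through [n = l + m], with [z = X] and
   [w = g(X)]. *)
rewrite -sum_mexpD; last first.
  move=> n nB; rewrite xB ?linear0 ?scale0r //.
  by apply: contra nB; exact: mbox_addr.
apply: eq_bigr => l _; rewrite raddf_sum /=; apply: eq_bigr => m _.
rewrite ev_tens mexp_alg -[k + l + m]addrA.
have [_ ->] := gm.
have -> c y : g (c *: y) = c * g y by exact: linearZ_LR.
rewrite char_PXpow HXE /mexp.
exact: scaler_mul_alg.
Qed.

Lemma eG_eqv a b : eqv a b -> eG a = eG b.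
Proof.
elim=> [//|? ? _ -> //|? ? ? _ -> _ -> //|? ?|? ? ?|?|? ? ? ? _ e1 _ e2|k a' b' ab e1].
- by rewrite !eGM; exact: mulrC.
- by rewrite !eGM; exact: mulrA.
- by rewrite eGM eG1 mul1r.
- by rewrite !eGM e1 e2.
- by rewrite !eGI e1 (eval_expr_eqv R ab).
Qed.

Lemma GammaE x : Gamma g x = linext (fun t => eG (frepr t)) x.
Proof.
rewrite /Gamma -/(ev g _) [in LHS]unlock [in RHS]unlock raddf_sum /=.
apply: eq_bigr => t _; exact: evZ.
Qed.

End Action.

HB.instance Definition _ (d : nat) := Monoid.isComLaw.Build (fexpr d) (fone d)
  (@fmul d) (@fmulA d) (@fmulC d) (@fmul1 d).

(** * Polynomials and weight bounds on supports *)

Section MonomialSupport.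
Variables (R : realType) (d : nat).
Local Notation Hsp := (Hsp R d).
Implicit Types (k l n : mindex d) (t : fexpr d).

Lemma fXpow0 : fXpow 0 = fone d.
Proof. by rewrite /fXpow big1 // => i _; rewrite ffunE. Qed.

Lemma fpowD t p q : fpow t (p + q) = fmul (fpow t p) (fpow t q).
Proof. by elim: p => [|p IHp]; rewrite ?fmul1 //= IHp fmulA. Qed.

Lemma fXpowD k l : fXpow (k + l) = fmul (fXpow k) (fXpow l).
Proof.
by rewrite /fXpow -big_split; apply: eq_bigr => i _; rewrite ffunE fpowD.
Qed.

Lemma fXpow_munit (i : 'I_d) : fXpow (munit i) = fX i.
Proof.
rewrite /fXpow (bigD1 i) //=.
rewrite ffunE eqxx /= fmulr1 big1 /= ?fmulr1 // => j /negbTE ji.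
by rewrite ffunE eq_sym ji.
Qed.

Definition polys : set (fexpr d) := range (@fXpow d).

Lemma polysM t u : polys t -> polys u -> polys (fmul t u).
Proof. by move=> [k _ <-] [l _ <-]; exists (k + l); rewrite ?fXpowD. Qed.

Lemma polys_fone : polys (fone d).
Proof. by exists 0; rewrite ?fXpow0. Qed.

Lemma polys_fX (i : 'I_d) : polys (fX i).
Proof. by exists (munit i); rewrite ?fXpow_munit. Qed.

Lemma polys_fmono t : polys t -> fmono t.
Proof. by move=> [k _ <-]; exact: fmono_fXpow. Qed.

Lemma supp_in1 (S : set (fexpr d)) : S (fone d) -> supp_in S (1 : Hsp).
Proof. by move=> S1; rewrite -bvec_fone; exact: supp_in_bvec. Qed.

Lemma supp_in_mul (S S' S'' : set (fexpr d)) (x y : Hsp) :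
  (forall t u, S t -> S' u -> S'' (fmul t u)) ->
  supp_in S x -> supp_in S' y -> supp_in S'' (x * y).
Proof. exact: supp_inM. Qed.

Lemma polys_mexp n (z : 'I_d -> Hsp) :
  (forall i, supp_in polys (z i)) -> supp_in polys (mexp n z).
Proof.
move=> Pz; apply: supp_inZ; elim/big_ind: _ => [|x y|i _].
- exact: supp_in1 polys_fone.
- by move=> Px Py; apply: supp_in_mul Px Py; exact: polysM.
- elim: (n i) => [|q IHq]; first by rewrite expr0; exact: supp_in1 polys_fone.
  by rewrite exprS; apply: supp_in_mul (Pz i) IHq; exact: polysM.
Qed.

Section Weights.
Variables (s : 'I_d -> nat) (alpha beta : R).
Local Notation wt := (fweight s alpha beta).

Definition lew (w : R) : set (fexpr d) := [set t | wt t <= w].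
Definition ltw (w : R) : set (fexpr d) := [set t | wt t < w].

Lemma lew_mul (v w : R) (x y : Hsp) :
  supp_in (lew v) x -> supp_in (lew w) y -> supp_in (lew (v + w)) (x * y).
Proof.
by apply: supp_in_mul => t u tv uw; rewrite /lew /= fweightM; exact: lerD.
Qed.

Lemma lew_1 (w : R) : 0 <= w -> supp_in (lew w) (1 : Hsp).
Proof. by move=> w0; apply: supp_in1; rewrite /lew /= fweight1. Qed.

Lemma ltwW w : ltw w `<=` lew w.
Proof. by move=> t; exact: ltW. Qed.

Lemma lew_mexp n (z : 'I_d -> Hsp) :
  (forall i, supp_in (lew (s i)%:R) (z i)) ->
  supp_in (lew (Defs.mweight R s n)) (mexp n z).
Proof.
move=> wz; apply: supp_inZ; rewrite /Defs.mweight natr_sum.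
elim: (index_enum _) => [|i r IHr]; first by rewrite !big_nil; exact: lew_1.
rewrite !big_cons; apply: lew_mul => //.
elim: (n i) => [|q IHq]; first by rewrite expr0 muln0; exact: lew_1.
by rewrite exprS mulnS natrD; exact: lew_mul.
Qed.

Lemma PJ_lew k w (x : Hsp) : supp_in (lew w) x ->
  w + beta - Defs.mweight R s k <= 0 -> PJ s alpha beta k x = 0.
Proof.
move=> xw kw; apply: linear_supp0 xw => t tw.
apply: PJ_eq0; rewrite /is_Jgen negb_and -leNgt /=; apply/orP; right.
by apply: le_trans kw; rewrite lerD2r lerD2r.
Qed.

Lemma PJ_fmono k (x : Hsp) : supp_in [set t | fmono t] x -> PJ s alpha beta k x = 0.
Proof.
move=> xm; apply: linear_supp0 xm => t tm.
by apply: PJ_eq0; rewrite /is_Jgen negb_and negbK /= tm.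
Qed.

Lemma HI_fmono k (x : Hsp) : supp_in [set t | fmono t] x -> HI k x = 0.
Proof. by move=> xm; apply: linear_supp0 xm => t; exact: HI_mono. Qed.

Lemma supp_in_HI k (S S' : set (fexpr d)) (x : Hsp) :
  (forall t v, S t -> fI k t = Some v -> S' v) ->
  supp_in S x -> supp_in S' (HI k x).
Proof.
move=> SS' Sx; apply: (@supp_in_linext _ _ _ S) => // t St.
case E: (fI k t) => [v|] /=; last exact: supp_in0.
by apply: supp_in_bvec; exact: SS' E.
Qed.

(* [n] is bounded strictly because [J_{k+n} t] vanishes unless its weight is
   positive. *)
Lemma ltw_mexp_sum (c : mindex d -> R) (z : 'I_d -> Hsp) k w B :
  (forall i, supp_in (lew (s i)%:R) (z i)) ->
  (forall n, w + beta - Defs.mweight R s (k + n) <= 0 -> c n = 0) ->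
  supp_in (ltw (w + beta - Defs.mweight R s k))
    (\sum_(n <- mbox d B) c n *: mexp n z).
Proof.
move=> wz c0; apply: supp_in_sum => n _ _.
have [/c0 ->|] := leP (w + beta - Defs.mweight R s (k + n)) 0.
  by rewrite scale0r; exact: supp_in0.
rewrite mweightD opprD addrA subr_gt0 => nw; apply: supp_inZ.
by apply: supp_inW (lew_mexp wz) => t tn; exact: le_lt_trans tn nw.
Qed.

End Weights.
End MonomialSupport.

Lemma scaler_lin (R : pzRingType) (V : lmodType R) (c p q : R) (v : V) :
  (c * p + q) *: v = c *: (p *: v) + q *: v.
Proof. by rewrite scalerDl scalerA. Qed.

Lemma scaler_add4 (R : pzRingType) (V : lmodType R) (c : R) (u v u' v' : V) :
  c *: (u + v) + (u' + v') = c *: u + u' + (c *: v + v').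
Proof. by rewrite scalerDr addrACA. Qed.

(** * Multiplicativity and triangularity of the action *)

Section ActionProperties.
Variables (R : realType) (d : nat) (s : 'I_d -> nat) (alpha beta : R).
Hypothesis ss : is_scaling s.
Local Notation Hplus := (Hplus s alpha beta).
Local Notation Hsp := (Hsp R d).
Local Notation PJ := (PJ s alpha beta).
Local Notation PX := (PX s alpha beta).
Local Notation X := (Xvar R (d := d)).
Local Notation wt := (fweight s alpha beta).
Local Notation polys := (@polys d).
Local Notation lewt := (lew s alpha beta).
Local Notation ltwt := (ltw s alpha beta).
Implicit Types (t u v : fexpr d) (x y : Hsp).

(** [Gamma g] as a linear extension, which makes linearity immediate; [GammaE] identifies the
    two. *)
Definition Gm (g : {linear Hplus -> R^o}) : Hsp -> Hsp :=
  linext (fun t => eG g (frepr t)).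

HB.instance Definition _ (g : {linear Hplus -> R^o}) :=
  GRing.Linear.copy (Gm g) (linext _).

Section OneCharacter.
Variable g : {linear Hplus -> R^o}.
Hypothesis gm : monoid_morphism g.
Local Notation Gm := (Gm g).

Lemma Gm_bvec t : Gm (bvec R t) = eG g (frepr t).
Proof. exact: linext_bvec. Qed.

Lemma Gm_fone : Gm (bvec R (fone d)) = 1.
Proof. by rewrite Gm_bvec (eG_eqv ss gm (frepr_pi _)) eG1. Qed.

Lemma Gm_fXi : Gm (bvec R (fXi d)) = bvec R (fXi d).
Proof. by rewrite Gm_bvec (eG_eqv ss gm (frepr_pi _)) eGXi. Qed.

Lemma Gm_X i : Gm (X i) = X i + (g (PX i))%:A.
Proof. by rewrite Gm_bvec (eG_eqv ss gm (frepr_pi _)) eGX. Qed.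

Lemma Gm_fmul t u : Gm (bvec R (fmul t u)) = Gm (bvec R t) * Gm (bvec R u).
Proof. by rewrite !Gm_bvec (eG_eqv ss gm (frepr_mul _ _)) eGM. Qed.

Lemma Gm_fI k t v : fI k t = Some v ->
  Gm (bvec R v) = HI k (Gm (bvec R t)) + Gpoly g k (bvec R t).
Proof.
move=> tv; rewrite !Gm_bvec (eG_eqv ss gm (fI_eqv tv)) (eGI ss gm).
by rewrite eval_expr_frepr.
Qed.

Lemma Gm1 : Gm 1 = 1.
Proof. by rewrite -bvec_fone Gm_fone bvec_fone. Qed.

Lemma GmM x y : Gm (x * y) = Gm x * Gm y.
Proof.
by apply: linextM => t u; rewrite -!Gm_bvec; exact: Gm_fmul.
Qed.

Lemma GmZ c x : Gm (c *: x) = c *: Gm x.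
Proof. exact: linearZ_LR. Qed.

Lemma GmD x y : Gm (x + y) = Gm x + Gm y.
Proof. exact: linearD. Qed.

Lemma Gm_sum (I : Type) (r : seq I) (F : I -> Hsp) :
  Gm (\sum_(i <- r) F i) = \sum_(i <- r) Gm (F i).
Proof. exact: linear_sum. Qed.

Lemma GmX x n : Gm (x ^+ n) = Gm x ^+ n.
Proof. by elim: n => [|n IHn]; rewrite ?expr0 ?Gm1 // !exprS GmM IHn. Qed.

Lemma Gm_mexp n (z : 'I_d -> Hsp) : Gm (mexp n z) = mexp n (fun i => Gm (z i)).
Proof.
rewrite /mexp GmZ; congr (_ *: _).
by rewrite (big_morph Gm GmM Gm1); apply: eq_bigr => i _; exact: GmX.
Qed.

Lemma Gm_alg (c : R) : Gm c%:A = c%:A.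
Proof. by rewrite GmZ Gm1. Qed.

Lemma Xshift_lew (c : R) i : supp_in (lewt (s i)%:R) (X i + c%:A).
Proof.
apply: supp_inD; first by apply: supp_in_bvec; rewrite /lew /= fweightX.
by apply: supp_inZ; apply: lew_1; exact: ler0n.
Qed.

Lemma Xshift_polys (c : R) i : supp_in polys (X i + c%:A).
Proof.
apply: supp_inD; first by apply: supp_in_bvec; exact: polys_fX.
by apply: supp_inZ; apply: supp_in1; exact: polys_fone.
Qed.

Lemma Gpoly_polys k x : supp_in polys (Gpoly g k x).
Proof.
have [B xB] := PJ_bound alpha beta x ss.
rewrite (GpolyE g k xB); apply: supp_in_sum => n _ _; apply: supp_inZ.
by apply: polys_mexp => i; exact: Xshift_polys.
Qed.

Lemma Gpoly_ltw k w x : supp_in (lewt w) x ->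
  supp_in (ltwt (w + beta - Defs.mweight R s k)) (Gpoly g k x).
Proof.
move=> xw; have [B xB] := PJ_bound alpha beta x ss.
rewrite (GpolyE g k xB); apply: ltw_mexp_sum => [i|n kn]; first exact: Xshift_lew.
by rewrite (PJ_lew xw kn) linear0.
Qed.

Lemma Gpoly_mono k t : fmono t -> Gpoly g k (bvec R t) = 0.
Proof.
move=> tm; apply: fsbig1 => n _; rewrite PJ_fmono ?linear0 ?scale0r //.
exact: supp_in_bvec.
Qed.

Lemma Gpoly_linear k : linear (Gpoly g k).
Proof.
move=> c x y.
have [B [xB yB]] := PJ_bound2 alpha beta x y ss.
have PJP l : PJ l (c *: x + y) = c *: PJ l x + PJ l y by exact: linearP.
rewrite (GpolyE g k xB) (GpolyE g k yB) (@GpolyE _ _ _ _ _ g k _ B); last first.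
  by move=> l lB; rewrite PJP xB // yB // scaler0 addr0.
rewrite scaler_sumr -big_split; apply: eq_bigr => n _ /=.
have gP p q : g (c *: p + q) = c * g p + g q by exact: linearP.
by rewrite PJP gP; exact: scaler_lin.
Qed.

Lemma Gm_fmono t : fmono t -> supp_in [set u | fmono u] (Gm (bvec R t)).
Proof.
elim/fexpr_ind: t => [_||i _|t u IHt IHu|k t v /fI_eqv tv _].
- by rewrite Gm_fone; apply: supp_in1; exact: fmono_fone.
- by rewrite /fmono (is_mono_eqv (frepr_pi _)).
- by rewrite Gm_X; apply: supp_inW (@Xshift_polys (g (PX i)) i) => u; exact: polys_fmono.
- rewrite fmonoM Gm_fmul => /andP[/IHt tm /IHu um].
  by apply: supp_in_mul tm um => a b /= am bm; rewrite fmonoM am.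
- by rewrite /fmono (is_mono_eqv tv).
Qed.

(** The formula for [I_k t] holds on all of [H]: if [t] is a monomial [X^l], then [Gm] keeps it
    polynomial, and all three terms vanish. *)
Lemma GmI k x : Gm (HI k x) = HI k (Gm x) + Gpoly g k x.
Proof.
elim/malg_ind: x => [|c x t IHx].
  have Gp0 : Gpoly g k 0 = 0 by apply: fsbig1 => n _; rewrite !linear0 scale0r.
  by rewrite !linear0 Gp0 addr0.
have HIP a b : HI k (c *: a + b) = c *: HI k a + HI k b by exact: linearP.
have GpP a b : Gpoly g k (c *: a + b) = c *: Gpoly g k a + Gpoly g k b.
  exact: Gpoly_linear.
have E : Gm (HI k (bvec R t)) = HI k (Gm (bvec R t)) + Gpoly g k (bvec R t).
  have [tm|/(fI_some k)[v tv]] := boolP (fmono t).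
    rewrite (HI_mono R k tm) (Gpoly_mono k tm) (HI_fmono k (Gm_fmono tm)).
    by rewrite linear0 addr0.
  exact: etrans (congr1 Gm (HI_bvec R tv)) (Gm_fI tv).
rewrite HIP [LHS]GmD [X in X + _]GmZ IHx E [Gm (_ + _)]GmD [Gm (_ *: _)]GmZ.
rewrite HIP GpP.
exact: scaler_add4.
Qed.

(** At [I_k t], the polynomial that is added contains a term of index [n] only if [J_{k+n} t] is
    nonzero, that is [|n| < |t| + beta - |k|], which is the weight of [I_k t]. *)
Lemma Gm_ltw t : supp_in (ltwt (wt t)) (Gm (bvec R t) - bvec R t).
Proof.
have le_wt u : supp_in (ltwt (wt u)) (Gm (bvec R u) - bvec R u) ->
    supp_in (lewt (wt u)) (Gm (bvec R u)).
  move=> uw; rewrite -[Gm _](subrK (bvec R u)); apply: supp_inD.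
    by apply: supp_inW uw; exact: ltwW.
  by apply: supp_in_bvec; exact: lexx.
elim/fexpr_ind: t => [||i|t u IHt IHu|k t v tv IHt].
- by rewrite Gm_fone bvec_fone subrr; exact: supp_in0.
- by rewrite Gm_fXi subrr; exact: supp_in0.
- rewrite Gm_X addrC addKr; apply: supp_inZ; apply: supp_in1.
  by rewrite /ltw /= fweight1 fweightX ltr0n; case: ss.
- rewrite Gm_fmul bvec_fmul.
  have -> : Gm (bvec R t) * Gm (bvec R u) - bvec R t * bvec R u =
     (Gm (bvec R t) - bvec R t) * Gm (bvec R u)
       + bvec R t * (Gm (bvec R u) - bvec R u).
    by rewrite mulrBl mulrBr addrA subrK.
  rewrite fweightM; apply: supp_inD.
    apply: supp_in_mul IHt (le_wt _ IHu) => a b aw bw.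
    by rewrite /ltw /= fweightM; exact: ltr_leD.
  apply: (@supp_in_mul _ _ (lewt (wt t))) _ IHu => [a b aw bw|].
    by rewrite /ltw /= fweightM; exact: ler_ltD.
  by apply: supp_in_bvec; exact: lexx.
- rewrite (Gm_fI tv) -(HI_bvec R tv) addrAC -linearB (fweightI _ _ _ tv).
  apply: supp_inD.
    apply: supp_in_HI IHt => a b aw /(fweightI s alpha beta) bE.
    by rewrite /ltw /= bE !ltrD2r.
  by apply: Gpoly_ltw; apply: supp_in_bvec; exact: lexx.
Qed.

Lemma Gm_lew w x : supp_in (lewt w) x -> supp_in (lewt w) (Gm x).
Proof.
move=> xw; apply: (supp_in_linext _ xw) => t tw; rewrite -Gm_bvec.
rewrite -[Gm _](subrK (bvec R t)); apply: supp_inD; last exact: supp_in_bvec.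
by apply: supp_inW (@Gm_ltw t) => u /ltW ut; exact: le_trans ut tw.
Qed.

Lemma Gm_sub_ltw w x : supp_in [set t | wt t = w] x -> supp_in (ltwt w) (Gm x - x).
Proof.
move=> xw.
have GE : Gm x = \sum_(t <- msupp x) mcoeff t x *: Gm (bvec R t).
  by rewrite {1}(malg_bvecE x) Gm_sum; apply: eq_bigr => t _; exact: GmZ.
rewrite GE [X in _ - X]malg_bvecE -sumrB; apply: supp_in_sum => t tx _.
have tw : wt t = w by apply: xw; rewrite mcoeff_neq0.
by rewrite -scalerBr -tw; apply: supp_inZ; exact: Gm_ltw.
Qed.

End OneCharacter.
End ActionProperties.

(** * The product of characters *)

Section Product.
Variables (R : realType) (d : nat) (s : 'I_d -> nat) (alpha beta : R).
Hypothesis ss : is_scaling s.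
Local Notation Hplus := (Hplus s alpha beta).
Local Notation fplus := (fplus s alpha beta).
Local Notation pgen := (pgen s alpha beta).
Local Notation Hsp := (Hsp R d).
Local Notation PJ := (PJ s alpha beta).
Local Notation PX := (PX s alpha beta).
Local Notation X := (Xvar R (d := d)).
Local Notation wt := (fweight s alpha beta).
Implicit Types (t u v : fexpr d) (x y : Hsp).
Variables g h : {linear Hplus -> R^o}.
Hypotheses (gm : monoid_morphism g) (hm : monoid_morphism h).

Definition gmul_gen (v : pgen) : R := g (ev h (pgen_Delta v)).

(** Both [(I \otimes h) Delta^+] and [g] are multiplicative, so the product is determined by its
    values on generators. In particular it is a character. *)
Lemma gmulE : gmul g h = char_of gmul_gen.
Proof.
apply/funext => y; have [g1 gM] := gm.
transitivity (g (ev h (Deltaplus y))).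
  rewrite /gmul /ev linear_sum; apply: eq_bigr => m _.
  by rewrite mkmalgUE linearZ_LR mulrC.
rewrite [@Deltaplus]unlock ev_sum linear_sum /char_of [@linext]unlock.
apply: eq_bigr => m _; rewrite evZ linearZ_LR; congr (_ *: _).
have evprod (r : seq pgen) (F : pgen -> malg fplus Hplus) :
    ev h (\prod_(v <- r) F v) = \prod_(v <- r) ev h (F v).
  exact: (big_morph _ (fun a b => evM a b hm) (ev1 _ hm)).
have evX z q : ev h ((z : malg fplus Hplus) ^+ q) = ev h z ^+ q.
  by elim: q => [|q IHq]; rewrite ?expr0 ?(ev1 _ hm) // !exprS (evM _ _ hm) IHq.
rewrite evprod (char_prod _ _ gm); apply: eq_bigr => v _.
by rewrite evX (charX _ _ gm).
Qed.

Lemma gmul_character : character (gmul g h).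
Proof. by rewrite gmulE; exact: char_of_character. Qed.

Lemma gmul_PX i : gmul g h (PX i) = g (PX i) + h (PX i).
Proof.
have [g1 _] := gm; have [h1 _] := hm.
rewrite gmulE char_of_gen /gmul_gen [@pgen_Delta]unlock /= evD !ev_tens h1 scale1r.
rewrite linearD linearZ_LR g1; congr (_ + _); exact: mulr1.
Qed.

Lemma PJ_bound_seq (r : seq (fexpr d)) : exists B, forall t, t \in r ->
  forall l, l \notin mbox d B -> PJ l (bvec R t) = 0.
Proof.
elim: r => [|t r [B rB]]; first by exists 0%N.
have [B' tB] := PJ_bound alpha beta (bvec R t : Hsp) ss.
exists (maxn B B') => u; rewrite inE => /predU1P[->|ur] l lB.
  by apply: tB; apply: contra lB; apply: mboxS; exact: leq_maxr.
by apply: rB ur _ _; apply: contra lB; apply: mboxS; exact: leq_maxl.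
Qed.

Lemma gmul_PJ_gen k t : is_Jgen s alpha beta (k, t) ->
  gmul g h (PJ k (bvec R t)) =
  \sum_(l \in [set: mindex d])
    ((mfact l)%:R^-1 * \prod_i (- h (PX i)) ^+ l i)
      * g (PJ (k + l) (Gm h (bvec R t))) + h (PJ k (bvec R t)).
Proof.
move=> kt; have [g1 gM] := gm; have [h1 hM] := hm.
rewrite gmulE (PJ_gen kt) char_of_gen /gmul_gen [@pgen_Delta]unlock /= evD linearD /=.
congr (_ + _); last first.
  rewrite ev_tens linearZ_LR g1 -(PJ_gen kt); exact: mulr1.
pose z := Delta s alpha beta (bvec R t).
have [B1 zB] := PJ_bound_seq (msupp z).
have [B2 tB] := PJ_bound alpha beta (Gm h (bvec R t)) ss.
(* Two truncations are needed: before evaluation the sum over [l] is bounded by the support of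
   [Delta t], after evaluation by [Gamma_h t]. *)
pose B := maxn B1 B2.
have {}zB l u : u \in msupp z -> l \notin mbox d B -> PJ (k + l) (bvec R u) = 0.
  move=> uz lB; apply: zB => //.
  by apply: contra lB => /mbox_addr; apply: mboxS; exact: leq_maxl.
have {}tB l : l \notin mbox d B -> PJ (k + l) (Gm h (bvec R t)) = 0.
  move=> lB; apply: tB.
  by apply: contra lB => /mbox_addr; apply: mboxS; exact: leq_maxr.
rewrite (@fsbig_mbox _ _ _ B); last first.
  move=> l lB; rewrite [@tmap]unlock big_seq big1 // => u uz.
  by rewrite (zB _ _ uz lB) [@tens]unlock msupp0 big_nil.
rewrite (@fsbig_mbox _ _ _ B); last first.
  by move=> l lB; rewrite tB // linear0 mulr0.
rewrite ev_sum linear_sum; apply: eq_bigr => l _ /=.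
rewrite (@ev_tmap _ _ _ _ _ h _ _ (PJ (k + l))
  _ ((mfact l)%:R^-1 * \prod_i (- h (PX i)) ^+ l i)); last first.
  move=> y; rewrite hM linearZ_LR; congr (_ * _ * _).
  rewrite /PXNpow (char_prod _ _ hm); apply: eq_bigr => i _.
  by rewrite (charX _ _ hm) linearN.
rewrite linearZ_LR; congr (_ * g (PJ _ _)).
exact: GammaE.
Qed.

(** Extends the formula to pairs for which [J_k t] is 0 by convention. All [J_{k+l} Gamma_h t] then
    vanish too: [Gamma_h] preserves polynomials and does not raise the weight, while
    [|k + l| >= |k|]. *)
Lemma gmul_PJ k t B :
  (forall l, l \notin mbox d B -> PJ l (Gm h (bvec R t)) = 0) ->
  gmul g h (PJ k (bvec R t)) =
  \sum_(l <- mbox d B)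
    ((mfact l)%:R^-1 * \prod_i (- h (PX i)) ^+ l i)
      * g (PJ (k + l) (Gm h (bvec R t))) + h (PJ k (bvec R t)).
Proof.
move=> tB; have [kt|kt] := boolP (is_Jgen s alpha beta (k, t)).
  rewrite (gmul_PJ_gen kt); congr (_ + _); apply: fsbig_mbox => l lB.
  by rewrite tB ?linear0 ?mulr0 //; apply: contra lB; exact: mbox_addr.
have [f [fE _]] := charP gmul_character.
rewrite PJ_eq0 // linear0 addr0 fE linear0 big1 // => l _.
suff -> : PJ (k + l) (Gm h (bvec R t)) = 0 by rewrite linear0 mulr0.
move: kt; rewrite /is_Jgen negb_and negbK -leNgt /= => /orP[tm|kt].
  by apply: PJ_fmono; exact: Gm_fmono.
apply: (@PJ_lew _ _ _ _ _ _ (wt t)).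
  by apply: Gm_lew => //; apply: supp_in_bvec; exact: lexx.
by apply: le_trans kt; rewrite lerD2l lerN2 mweightD lerDl; exact: mweight_ge0.
Qed.

(** Put [Z = X + g(X) + h(X)]. The factors [(-h(X))^l / l!] coming from [Delta^+] shift [Z] back to
    [X + g(X)], which gives the first term; the second arises because [Gm g] maps [X + h(X)] to
    [Z]. *)
Lemma Gpoly_gmul (f : {linear Hplus -> R^o}) k t : gmul g h = f ->
  Gpoly f k (bvec R t) = Gpoly g k (Gm h (bvec R t)) + Gm g (Gpoly h k (bvec R t)).
Proof.
move=> fE.
have [B [tB hB]] := PJ_bound2 alpha beta (bvec R t : Hsp) (Gm h (bvec R t)) ss.
rewrite (GpolyE f k tB) (GpolyE g k hB) (GpolyE h k tB).
pose Z i : Hsp := X i + (f (PX i))%:A.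
pose w i : Hsp := (- h (PX i))%:A.
have ZE i : X i + (g (PX i))%:A + (h (PX i))%:A = Z i.
  by rewrite /Z -fE gmul_PX scalerDl addrA.
have ZwE : (fun i => Z i + w i) = (fun i => X i + (g (PX i))%:A).
  by apply/funext => i; rewrite -ZE /w scaleNr addrK.
transitivity (\sum_(n <- mbox d B) \sum_(l <- mbox d B)
     mexp n Z * mexp l w * (g (PJ (k + (n + l)) (Gm h (bvec R t))))%:A
   + \sum_(n <- mbox d B) h (PJ (k + n) (bvec R t)) *: mexp n Z).
  rewrite -big_split; apply: eq_bigr => n _.
  have fPJ := congr1 (fun f' : Hplus -> R => f' (PJ (k + n) (bvec R t))) fE.
  rewrite -[f _]fPJ [X in X *: _](gmul_PJ (k + n) hB) [LHS]scalerDl; congr (_ + _).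
  rewrite scaler_suml; apply: eq_bigr => l _.
  rewrite mexp_alg addrA; exact: scaler_mul_alg.
congr (_ + _).
  pose c n : Hsp := (g (PJ (k + n) (Gm h (bvec R t))))%:A.
  rewrite (@sum_mexpD _ _ _ Z w c); last first.
    move=> n nB; have knB : k + n \notin mbox d B.
      by apply: contra nB; exact: mbox_addr.
    by rewrite /c (hB _ knB) linear0 scale0r.
  apply: eq_bigr => n _; rewrite /c; apply: etrans (mulr_algr _ _) _.
  exact: (congr1 (fun z : 'I_d -> Hsp => g (PJ (k + n) (Gm h (bvec R t))) *: mexp n z)
    ZwE).
rewrite Gm_sum; apply: eq_bigr => n _; rewrite GmZ; congr (_ *: _).
rewrite (Gm_mexp ss gm); congr (mexp n _); apply/funext => i.
apply/esym/(etrans (GmD _ _ _)).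
transitivity (X i + (g (PX i))%:A + (h (PX i))%:A); last exact: ZE.
congr (_ + _); [exact: Gm_X|exact: Gm_alg].
Qed.

Lemma Gm_gmul (f : {linear Hplus -> R^o}) x : gmul g h = f ->
  Gm f x = Gm g (Gm h x).
Proof.
move=> fE; have fm : monoid_morphism f by rewrite -fE; case: gmul_character.
elim/malg_ind: x => [|c x t IHx]; first by rewrite !linear0.
suff tE : Gm f (bvec R t) = Gm g (Gm h (bvec R t)).
  by rewrite !(GmD, GmZ) IHx tE.
elim/fexpr_ind: t => [||i|t u IHt IHu|k t v tv IHt].
- by rewrite !Gm_fone // Gm1.
- by rewrite !Gm_fXi.
- apply: etrans (Gm_X ss fm i) _; apply: esym.
  apply: etrans (congr1 (Gm g) (Gm_X ss hm i)) _; apply: etrans (GmD _ _ _) _.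
  transitivity (X i + (g (PX i))%:A + (h (PX i))%:A).
    by congr (_ + _); [exact: Gm_X|exact: Gm_alg].
  by rewrite -fE gmul_PX scalerDl addrA.
- by rewrite (Gm_fmul ss fm) (Gm_fmul ss hm) (GmM ss gm) IHt IHu.
- rewrite (Gm_fI ss fm tv) (Gm_fI ss hm tv) GmD (GmI ss gm) IHt (Gpoly_gmul _ _ fE).
  exact: addrA.
Qed.

End Product.

(** * Inverse characters *)

Section Inverse.
Variables (R : realType) (d : nat) (s : 'I_d -> nat) (alpha beta : R).
Hypothesis ss : is_scaling s.
Local Notation Hplus := (Hplus s alpha beta).
Local Notation pgen := (pgen s alpha beta).
Local Notation Hsp := (Hsp R d).
Local Notation PJ := (PJ s alpha beta).
Local Notation PX := (PX s alpha beta).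
Local Notation X := (Xvar R (d := d)).
Local Notation wt := (fweight s alpha beta).
Local Notation lewt := (lew s alpha beta).
Implicit Types (t u v : fexpr d) (x y : Hsp).
Variable g : {linear Hplus -> R^o}.
Hypothesis gm : monoid_morphism g.

Definition Lpoly (k : mindex d) (x : Hsp) : Hsp :=
  \sum_(n \in [set: mindex d]) g (PJ (k + n) x) *: mexp n X.

(* The inverse of [Gamma g]: [Gamma g] maps [I_k (L a)] to
   [I_k (Gamma g (L a)) + Gpoly g k (L a)], and [Lpoly k (L a)] to
   [Gpoly g k (L a)]. *)
Fixpoint eL (a : expr d) : Hsp :=
  match a with
  | EOne => 1
  | EXi => bvec R (fXi d)
  | EX i => X i - (g (PX i))%:A
  | EMul a b => eL a * eL b
  | EI k a => HI k (eL a) - Lpoly k (eL a)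
  end.

Lemma eL_eqv a b : eqv a b -> eL a = eL b.
Proof.
elim=> [//|? ? _ -> //|? ? ? _ -> _ -> //|? ?|? ? ?|?|? ? ? ? _ e1 _ e2|k a' b' ab e1] /=.
- exact: mulrC.
- exact: mulrA.
- exact: mul1r.
- by rewrite e1 e2.
- by rewrite e1.
Qed.

Definition Lt t : Hsp := eL (frepr t).

Lemma Lt_fone : Lt (fone d) = 1.
Proof. exact: eL_eqv (frepr_pi _). Qed.

Lemma Lt_fXi : Lt (fXi d) = bvec R (fXi d).
Proof. exact: eL_eqv (frepr_pi _). Qed.

Lemma Lt_fX i : Lt (fX i) = X i - (g (PX i))%:A.
Proof. exact: eL_eqv (frepr_pi _). Qed.

Lemma Lt_fmul t u : Lt (fmul t u) = Lt t * Lt u.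
Proof. exact: eL_eqv (frepr_mul _ _). Qed.

Lemma Lt_fI k t v : fI k t = Some v -> Lt v = HI k (Lt t) - Lpoly k (Lt t).
Proof. by move=> tv; exact: eL_eqv (fI_eqv tv). Qed.

Lemma LpolyE k x B : (forall l, l \notin mbox d B -> PJ l x = 0) ->
  Lpoly k x = \sum_(n <- mbox d B) g (PJ (k + n) x) *: mexp n X.
Proof.
move=> xB; apply: fsbig_mbox => n nB.
by rewrite xB ?linear0 ?scale0r //; apply: contra nB; exact: mbox_addr.
Qed.

Lemma X_lew i : supp_in (lewt (s i)%:R) (X i).
Proof. by apply: supp_in_bvec; rewrite /lew /= fweightX. Qed.

(** Together with [Lt_fmono], this makes the inverse compatible with truncation: if [J_k t] is 0, so
    is every [J_{k+l} (L t)]. *)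
Lemma Lt_lew t : supp_in (lewt (wt t)) (Lt t).
Proof.
elim/fexpr_ind: t => [||i|t u IHt IHu|k t v tv IHt].
- by rewrite Lt_fone; apply: lew_1; rewrite fweight1.
- by rewrite Lt_fXi; apply: supp_in_bvec; exact: lexx.
- rewrite Lt_fX -scaleNr fweightX; exact: Xshift_lew.
- by rewrite Lt_fmul fweightM; exact: lew_mul.
- rewrite (Lt_fI tv) (fweightI _ _ _ tv); apply: supp_inD.
    apply: supp_in_HI IHt => a b aw /(fweightI s alpha beta) bE.
    by rewrite /lew /= bE !lerD2r.
  apply: supp_inN; have [B xB] := PJ_bound alpha beta (Lt t) ss.
  rewrite (LpolyE k xB); apply: supp_inW (@ltwW _ _ _ _ _ _) _.
  apply: ltw_mexp_sum => [i|n kn]; first exact: X_lew.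
  by rewrite (PJ_lew IHt kn) linear0.
Qed.

Lemma Lt_fmono t : fmono t -> supp_in [set u | fmono u] (Lt t).
Proof.
elim/fexpr_ind: t => [_||i _|t u IHt IHu|k t v /fI_eqv tv _].
- by rewrite Lt_fone; apply: supp_in1; exact: fmono_fone.
- by rewrite /fmono (is_mono_eqv (frepr_pi _)).
- rewrite Lt_fX -scaleNr.
  by apply: supp_inW (@Xshift_polys _ _ (- g (PX i)) i) => u; exact: polys_fmono.
- rewrite fmonoM Lt_fmul => /andP[/IHt tm /IHu um].
  by apply: supp_in_mul tm um => a b /= am bm; rewrite fmonoM am.
- by rewrite /fmono (is_mono_eqv tv).
Qed.

(** Found by solving [Gpoly h k t = - Lpoly k (L t)] for the inverse character [h]. Expand
    [X = (X - g(X)) + g(X)] in [sum_n X^n / n! g(J_{k+n} L t)]: the coefficient of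
    [(X - g(X))^n / n!] is [inv_sum (k + n) t], and must equal [- h(J_{k+n} t)]. *)
Definition inv_sum (k : mindex d) t : R :=
  \sum_(l \in [set: mindex d])
    ((mfact l)%:R^-1 * \prod_i g (PX i) ^+ l i) * g (PJ (k + l) (Lt t)).

Lemma inv_sumE k t B : (forall l, l \notin mbox d B -> PJ l (Lt t) = 0) ->
  inv_sum k t = \sum_(l <- mbox d B)
    ((mfact l)%:R^-1 * \prod_i g (PX i) ^+ l i) * g (PJ (k + l) (Lt t)).
Proof.
move=> tB; apply: fsbig_mbox => l lB.
by rewrite tB ?linear0 ?mulr0 //; apply: contra lB; exact: mbox_addr.
Qed.

Definition inv_gen (v : pgen) : R :=
  match v with
  | inl i => - g (PX i)
  | inr p => - inv_sum (val p).1 (val p).2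
  end.

Definition ginv : Hplus -> R := char_of inv_gen.

Lemma ginv_PX i : ginv (PX i) = - g (PX i).
Proof. exact: char_of_gen. Qed.

Lemma ginv_PJ k t : ginv (PJ k (bvec R t)) = - inv_sum k t.
Proof.
have [kt|kt] := boolP (is_Jgen s alpha beta (k, t)).
  by rewrite (PJ_gen kt) /ginv char_of_gen.
have [f [fE _]] := charP (char_of_character inv_gen).
rewrite PJ_eq0 // /ginv fE linear0 /inv_sum fsbig1 ?oppr0 // => l _.
suff -> : PJ (k + l) (Lt t) = 0 by rewrite linear0 mulr0.
move: kt; rewrite /is_Jgen negb_and negbK -leNgt /= => /orP[tm|kt].
  by apply: PJ_fmono; exact: Lt_fmono.
apply: (PJ_lew (@Lt_lew t)).
by apply: le_trans kt; rewrite lerD2l lerN2 mweightD lerDl; exact: mweight_ge0.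
Qed.

Section WithInverse.
Variable h : {linear Hplus -> R^o}.
Hypothesis hE : ginv = h.

Lemma ginv_monoid : monoid_morphism h.
Proof. by rewrite -hE; case: (char_of_character inv_gen). Qed.

Lemma Gpoly_ginv k t : Gpoly h k (bvec R t) = - Lpoly k (Lt t).
Proof.
have [B [tB hB]] := PJ_bound2 alpha beta (bvec R t : Hsp) (Lt t) ss.
rewrite (GpolyE h k tB) (LpolyE k hB).
pose Z i : Hsp := X i + (h (PX i))%:A.
pose w i : Hsp := (g (PX i))%:A.
pose c n : Hsp := (g (PJ (k + n) (Lt t)))%:A.
have ZwE : (fun i => Z i + w i) = X.
  by apply/funext => i; rewrite /Z /w -hE ginv_PX scaleNr subrK.
transitivity (- (\sum_(n <- mbox d B) \sum_(l <- mbox d B)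
     mexp n Z * mexp l w * c (n + l))).
  rewrite -sumrN; apply: eq_bigr => n _.
  have hPJ := congr1 (fun h' : Hplus -> R => h' (PJ (k + n) (bvec R t))) hE.
  rewrite -[h _]hPJ [X in X *: _]ginv_PJ (inv_sumE _ hB) scaleNr; congr (- _).
  rewrite scaler_suml; apply: eq_bigr => l _.
  rewrite mexp_alg /c addrA; exact: scaler_mul_alg.
congr (- _); rewrite (@sum_mexpD _ _ _ Z w c); last first.
  move=> n nB; have knB : k + n \notin mbox d B.
    by apply: contra nB; exact: mbox_addr.
  by rewrite /c (hB _ knB) linear0 scale0r.
apply: eq_bigr => n _; apply: etrans (mulr_algr _ _) _.
exact: (congr1 (fun z : 'I_d -> Hsp => g (PJ (k + n) (Lt t)) *: mexp n z) ZwE).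
Qed.

Lemma Gm_ginv t : Gm h (bvec R t) = Lt t.
Proof.
have hm := ginv_monoid.
elim/fexpr_ind: t => [||i|t u IHt IHu|k t v tv IHt].
- by rewrite (Gm_fone ss hm) Lt_fone.
- by rewrite (Gm_fXi ss hm) Lt_fXi.
- apply: etrans (Gm_X ss hm i) _; rewrite Lt_fX; congr (_ + _).
  by rewrite -hE ginv_PX scaleNr.
- by rewrite (Gm_fmul ss hm) Lt_fmul IHt IHu.
- by rewrite (Gm_fI ss hm tv) (Lt_fI tv) IHt Gpoly_ginv.
Qed.

Lemma Gm_Lpoly k x : Gm g (Lpoly k x) = Gpoly g k x.
Proof.
have [B xB] := PJ_bound alpha beta x ss.
rewrite (LpolyE k xB) (GpolyE g k xB) Gm_sum; apply: eq_bigr => n _.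
rewrite GmZ; congr (_ *: _); rewrite (Gm_mexp ss gm); congr (mexp n _).
by apply/funext => i; exact: Gm_X.
Qed.

Lemma Gm_Lt t : Gm g (Lt t) = bvec R t.
Proof.
elim/fexpr_ind: t => [||i|t u IHt IHu|k t v tv IHt].
- by rewrite Lt_fone (Gm1 ss gm) bvec_fone.
- by rewrite Lt_fXi (Gm_fXi ss gm).
- rewrite Lt_fX -scaleNr GmD.
  transitivity (X i + (g (PX i))%:A + (- g (PX i))%:A).
    by congr (_ + _); [exact: Gm_X|exact: Gm_alg].
  by rewrite scaleNr addrK.
- by rewrite Lt_fmul (GmM ss gm) IHt IHu bvec_fmul.
- rewrite (Lt_fI tv) -scaleN1r GmD GmZ scaleN1r (GmI ss gm) Gm_Lpoly addrK IHt.
  exact: HI_bvec.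
Qed.

Lemma Gm_ginvK x : Gm g (Gm h x) = x.
Proof.
elim/malg_ind: x => [|c x t IHx]; first by rewrite !linear0.
by rewrite !(GmD, GmZ) IHx Gm_ginv Gm_Lt.
Qed.

End WithInverse.
End Inverse.

(** * Invariance under the structure group *)

Lemma fmono_polys (d : nat) (t : fexpr d) : fmono t -> polys t.
Proof.
elim/fexpr_ind: t => [_||i _|t u IHt IHu|k t v /fI_eqv tv _].
- exact: polys_fone.
- by rewrite /fmono (is_mono_eqv (frepr_pi _)).
- exact: polys_fX.
- by rewrite fmonoM => /andP[/IHt tp /IHu up]; exact: polysM.
- by rewrite /fmono (is_mono_eqv tv).
Qed.

(** Expanding the product picks one symbol from each factor. The choice is a total function on [I],
    so [u0] supplies its values outside [r]. *)
Lemma supp_in_prod (R : realType) (d : nat) (I : eqType) (r : seq I)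
    (S : I -> set (fexpr d)) (x : I -> Hsp R d) (u0 : I -> fexpr d) :
  uniq r -> (forall i, S i (u0 i)) -> (forall i, supp_in (S i) (x i)) ->
  supp_in [set t | exists u : I -> fexpr d, (forall i, S i (u i)) /\
                     t = \big[@fmul d/fone d]_(i <- r) u i] (\prod_(i <- r) x i).
Proof.
move=> + Su0 Sx; elim: r => [_|i r IHr /andP[ir ur]].
  by rewrite big_nil; apply: supp_in1; exists u0; rewrite big_nil.
rewrite big_cons; apply: supp_in_mul (Sx i) (IHr ur) => a b Sa [u [Su bE]].
exists (fun j => if j == i then a else u j); split.
  by move=> j; case: eqP => [->|].
rewrite big_cons eqxx bE; congr (fmul _ _); apply: eq_big_seq => j jr.
by case: eqP => // ji; rewrite -ji jr in ir.
Qed.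

Section Invariance.
Variables (R : realType) (d : nat) (s : 'I_d -> nat) (alpha beta : R).
Hypothesis ss : is_scaling s.
Variables (N : nat) (e : 'I_N -> nl_term R d).
Local Notation Hplus := (Hplus s alpha beta).
Local Notation Hsp := (Hsp R d).
Implicit Types (t u v : fexpr d) (x y : Hsp).

Definition Pset (n : nat) := (WUP e n).2.

Lemma WsetS n : Wset e n.+1 = Wset e n `|` [set t | exists m q k,
  in_MF e m q k /\ subst_monomial m q k (Uset e n) (Pset n) t].
Proof. by rewrite /Wset /Uset /Pset /=; case: (WUP e n) => [[]]. Qed.

Lemma UsetS n : Uset e n.+1 = poly_or_int 0 (Wset e n.+1).
Proof. by rewrite /Wset /Uset /Pset /=; case: (WUP e n) => [[]]. Qed.

Lemma PsetS n i : Pset n.+1 i = poly_or_int (munit i) (Wset e n.+1).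
Proof. by rewrite /Wset /Uset /Pset /=; case: (WUP e n) => [[]]. Qed.

Section OneCharacter.
Variable g : {linear Hplus -> R^o}.
Hypothesis gm : monoid_morphism g.

Definition Gm_invariant (S : set (fexpr d)) :=
  forall t, S t -> supp_in S (Gm g (bvec R t)).

Lemma Gm_polys : Gm_invariant (@polys d).
Proof.
move=> t /polys_fmono /(Gm_fmono ss gm); apply: supp_inW => u; exact: fmono_polys.
Qed.

(** What the action adds to an integrated symbol is a polynomial, and all monomials [X^l] belong to
    [poly_or_int k W]. *)
Lemma poly_or_int_invariant k W : Gm_invariant W -> Gm_invariant (poly_or_int k W).
Proof.
move=> IW v [vp|[t Wt tv]].
  by apply: supp_inW (Gm_polys vp) => u up; left.
rewrite (Gm_fI ss gm tv); apply: supp_inD.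
  by apply: supp_in_HI (IW t Wt) => a b Wa ab; right; exists a.
by apply: supp_inW (@Gpoly_polys _ _ _ _ _ ss g k (bvec R t)) => u up; left.
Qed.

Lemma Gm_prod (I : Type) (r : seq I) (u : I -> fexpr d) :
  Gm g (bvec R (\big[@fmul d/fone d]_(i <- r) u i)) = \prod_(i <- r) Gm g (bvec R (u i)).
Proof.
elim: r => [|i r IHr]; first by rewrite !big_nil; exact: Gm_fone.
by rewrite !big_cons (Gm_fmul ss gm) IHr.
Qed.

(** The action is multiplicative and fixes [Xi]. Since different occurrences of [U] or [P_i] may be
    replaced by different elements, expanding the product yields substitutions of the same
    monomial. *)
Lemma subst_invariant m q k U P : Gm_invariant U -> (forall i, Gm_invariant (P i)) ->
  Gm_invariant (subst_monomial m q k U P).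
Proof.
move=> IU IP t [u [p [Uu Pp ->]]].
rewrite !(Gm_fmul ss gm).
have XiE : Gm g (bvec R (fpow (fXi d) m)) = bvec R (fpow (fXi d) m).
  elim: m => [|m IHm] /=; first by rewrite Gm_fone // bvec_fone.
  by rewrite (Gm_fmul ss gm) (Gm_fXi ss gm) IHm bvec_fmul.
rewrite XiE !Gm_prod.
have uS := @supp_in_prod R d _ (index_enum 'I_q) (fun=> U) (fun j => Gm g (bvec R (u j))) u
  (index_enum_uniq _) Uu (fun j => IU _ (Uu j)).
have XiS : supp_in [set fpow (fXi d) m] (bvec R (fpow (fXi d) m) : Hsp).
  exact: supp_in_bvec.
pose Pk i := [set t | exists p : 'I_(k i) -> fexpr d,
  (forall j, P i (p j)) /\ t = \big[@fmul d/fone d]_j p j].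
have pS i : supp_in (Pk i) (Gm g (bvec R (\big[@fmul d/fone d]_j p i j))).
  rewrite Gm_prod; apply: (@supp_in_prod _ _ _ _ (fun=> P i) _ (p i)) => [|//|j].
    exact: index_enum_uniq.
  exact: IP.
have ppS := @supp_in_prod R d _ (index_enum 'I_d) Pk _
  (fun i => \big[@fmul d/fone d]_j p i j) (index_enum_uniq _)
  (fun i => ex_intro _ (p i) (conj (Pp i) erefl)) pS.
pose S2 := [set t | exists u : 'I_q -> fexpr d, (forall j, U (u j)) /\
  t = fmul (fpow (fXi d) m) (\big[@fmul d/fone d]_j u j)].
have uS2 : supp_in S2 (bvec R (fpow (fXi d) m) * \prod_j Gm g (bvec R (u j))).
  apply: supp_in_mul XiS uS => a b -> [u' [Uu' ->]]; by exists u'.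
apply: supp_in_mul uS2 ppS => a b [u' [Uu' ->]] [w [wP ->]].
(* For each [i] the factors are only known to exist; choice assembles them into the dependent family
   that [subst_monomial] asks for. *)
pose p' i := projT1 (cid (wP i)).
exists u', p'; split=> // [i|]; first by have [] := projT2 (cid (wP i)).
by congr (fmul _ _); apply: eq_bigr => i _; have [] := projT2 (cid (wP i)).
Qed.

Lemma WU_invariant n : [/\ Gm_invariant (Wset e n), Gm_invariant (Uset e n) &
  forall i, Gm_invariant (Pset n i)].
Proof.
elim: n => [|n [IW IU IP]]; first by split=> [t []|t []|i t []].
have IWn : Gm_invariant (Wset e n.+1).
  rewrite WsetS => t [Wt|[m [q [k [mqk tS]]]]].
    by apply: supp_inW (IW t Wt) => u Wu; left.
  apply: supp_inW (subst_invariant IU IP tS) => u uS.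
  by right; exists m, q, k.
split=> //; first by rewrite UsetS; exact: poly_or_int_invariant.
by move=> i; rewrite PsetS; exact: poly_or_int_invariant.
Qed.

Lemma Wall_invariant : Gm_invariant (Wall e).
Proof.
move=> t [n _ Wt]; have [IW _ _] := WU_invariant n.
by apply: supp_inW (IW t Wt) => u Wu; exists n.
Qed.

Lemma FF_invariant : Gm_invariant (FF e).
Proof.
move=> t [n _ Ft]; have [IW IU _] := WU_invariant n.
by case: Ft => Ft; [apply: supp_inW (IW t Ft)|apply: supp_inW (IU t Ft)] => u Wu;
  exists n => //; [left|right].
Qed.

Lemma Gm_supp S x : Gm_invariant S -> supp_in S x -> supp_in S (Gm g x).
Proof. by move=> IS Sx; apply: (supp_in_linext _ Sx) => t St; rewrite -Gm_bvec; exact: IS. Qed.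

End OneCharacter.
End Invariance.

(** * Local subcriticality and finiteness *)

Section Size.
Variable d : nat.
Implicit Types (a b : expr d) (t u v : fexpr d) (k : mindex d).

(** The unit has size 0, which makes the size compatible with [eqv]. *)
Fixpoint esize a : nat :=
  match a with
  | EOne => 0
  | EXi | EX _ => 1
  | EMul a b => esize a + esize b
  | EI _ a => (esize a).+1
  end.

Definition fsize t := esize (frepr t).

Lemma esize_eqv a b : eqv a b -> esize a = esize b.
Proof.
elim=> //= [? ? ? _ -> _ //|? ?|? ? ?|? ? ? ? _ -> _ -> //|? ? ? _ -> //].
- exact: addnC.
- exact: addnA.
Qed.

Lemma fsizeM t u : fsize (fmul t u) = (fsize t + fsize u)%N.
Proof. by rewrite /fsize (esize_eqv (frepr_mul t u)). Qed.

Lemma fsizeI k t v : fI k t = Some v -> fsize v = (fsize t).+1.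
Proof. by move=> /fI_eqv tv; rewrite /fsize (esize_eqv tv). Qed.

(* The only operators occurring in [F_F] are [I] and the [I_i]. *)
Definition low_index k : bool := (k == 0) || [exists i, k == munit i].

Fixpoint elow a : bool :=
  match a with
  | EOne | EXi | EX _ => true
  | EMul a b => elow a && elow b
  | EI k a => low_index k && elow a
  end.

Definition flow t := elow (frepr t).

Lemma elow_eqv a b : eqv a b -> elow a = elow b.
Proof.
elim=> //= [? ? ? _ -> _ //|? ?|? ? ?|? ? ? ? _ -> _ -> //|? ? ? _ -> //].
- exact: andbC.
- exact: andbA.
Qed.

Lemma flowM t u : flow (fmul t u) = flow t && flow u.
Proof. by rewrite /flow (elow_eqv (frepr_mul t u)). Qed.

Lemma flowI k t v : fI k t = Some v -> flow v = low_index k && flow t.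
Proof. by move=> /fI_eqv tv; rewrite /flow (elow_eqv tv). Qed.

Lemma flow_fone : flow (fone d).
Proof. by rewrite /flow (elow_eqv (frepr_pi _)). Qed.

Lemma flow_fXi : flow (fXi d).
Proof. by rewrite /flow (elow_eqv (frepr_pi _)). Qed.

Lemma flow_fX (i : 'I_d) : flow (fX i).
Proof. by rewrite /flow (elow_eqv (frepr_pi _)). Qed.

Lemma flow_pow t n : flow t -> flow (fpow t n).
Proof. by move=> tl; elim: n => [|n IHn]; [exact: flow_fone|rewrite /= flowM tl]. Qed.

Lemma flow_prod (I : Type) (r : seq I) (F : I -> fexpr d) :
  (forall i, flow (F i)) -> flow (\big[@fmul d/fone d]_(i <- r) F i).
Proof.
move=> Fl; elim: r => [|i r IHr]; first by rewrite big_nil flow_fone.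
by rewrite big_cons flowM Fl.
Qed.

Definition atomic t : Prop :=
  [\/ t = fXi d, exists i, t = fX i | exists k u, fI k u = Some t].

(** An atomic factor has positive size, so splitting it off leaves a smaller cofactor; [finite_size]
    proceeds by this induction. *)
Lemma atomic_factor t : t = fone d \/
  exists r u : fexpr d, atomic r /\ t = fmul r u.
Proof.
elim/fexpr_ind: t => [||i|t u [->|[a [t' [aa ->]]]] IHu|k t v tv _].
- by left.
- by right; exists (fXi d), (fone d); split; [constructor|rewrite fmulr1].
- by right; exists (fX i), (fone d); split; [constructor 2; exists i|rewrite fmulr1].
- by rewrite fmul1.
- by right; exists a, (fmul t' u); rewrite fmulA.
- by right; exists v, (fone d); split; [constructor 3; exists k, t|rewrite fmulr1].
Qed.

Lemma fsize_atomic t : atomic t -> (0 < fsize t)%N.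
Proof.
case=> [->|[i ->]|[k [u /fsizeI -> //]]];
  by rewrite /fsize (esize_eqv (frepr_pi _)).
Qed.

Lemma finite_low_index : finite_set [set k : mindex d | low_index k].
Proof.
apply: (@sub_finite_set _ _ ([set 0] `|` (@munit d) @` [set: 'I_d])).
  by move=> k /= /orP[/eqP ->|/existsP[i /eqP ->]]; [left|right; exists i].
by rewrite finite_setU; split; [exact: finite_set1|exact/finite_image/finite_finset].
Qed.

(** A symbol of size at most [n + 1] other than the unit is an atomic symbol times one of size at
    most [n]; the atomic one is [Xi], some [X_i], or an integral, with one of finitely many indices,
    of a symbol of size at most [n]. *)
Lemma finite_size n : finite_set [set t | flow t /\ (fsize t <= n)%N].
Proof.
elim: n => [|n IHn].
  apply: (@sub_finite_set _ _ [set fone d]); last exact: finite_set1.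
  move=> t [_]; rewrite leqn0 => /eqP t0.
  have [//|[a [u [/fsize_atomic a0 tE]]]] := atomic_factor t.
  by move: t0; rewrite tE fsizeM => /eqP; rewrite addn_eq0 => /andP[/eqP a00]; rewrite a00 in a0.
set Sn := [set t | flow t /\ (fsize t <= n)%N] in IHn *.
(* The default value for excluded integrals can only enlarge the finite set. *)
pose fI' (kt : mindex d * fexpr d) : fexpr d := odflt (fone d) (fI kt.1 kt.2).
pose At := [set fXi d] `|` (@fX d) @` [set: 'I_d]
  `|` fI' @` ([set k | low_index k] `*` Sn).
have fAt : finite_set At.
  rewrite !finite_setU; split; first split.
  - exact: finite_set1.
  - exact/finite_image/finite_finset.
  - by apply: finite_image; apply: finite_setX => //; exact: finite_low_index.
apply: (@sub_finite_set _ _ ([set fone d] `|`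
    (fun at_ => fmul at_.1 at_.2) @` (At `*` Sn))); last first.
  rewrite finite_setU; split; first exact: finite_set1.
  by apply: finite_image; exact: finite_setX.
move=> t [tl tn]; have [->|[a [u [aa tE]]]] := atomic_factor t; first by left.
right; have a0 := fsize_atomic aa.
move: tl tn; rewrite tE flowM fsizeM => /andP[al ul] aun.
exists (a, u) => //; split=> /=; last first.
  by split=> //; rewrite -ltnS; apply: leq_trans aun; rewrite -add1n leq_add2r.
case: aa => [->|[i ->]|[k [v va]]]; first by left; left.
  by left; right; exists i.
right; exists (k, v); last by rewrite /fI' /= va.
move: al; rewrite (flowI va) => /andP[kl vl]; split=> //; split=> //=.
by rewrite -ltnS -(fsizeI va); apply: leq_trans aun; exact: leq_addr.
Qed.

End Size.

(** * The weight penalized by the size *)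

Section Potential.
Variables (R : realType) (d : nat) (s : 'I_d -> nat) (alpha beta eps : R).
Implicit Types (t u v : fexpr d) (k : mindex d).
Local Notation wt := (fweight s alpha beta).

Definition pot t : R := wt t - eps *+ fsize t.

Lemma potM t u : pot (fmul t u) = pot t + pot u.
Proof. by rewrite /pot fweightM fsizeM mulrnDr opprD addrACA. Qed.

Lemma pot_fone : pot (fone d) = 0.
Proof. by rewrite /pot fweight1 /fsize (esize_eqv (frepr_pi _)) subr0. Qed.

Lemma pot_fXi : pot (fXi d) = alpha - eps.
Proof. by rewrite /pot fweightXi /fsize (esize_eqv (frepr_pi _)). Qed.

Lemma pot_fX (i : 'I_d) : pot (fX i) = (s i)%:R - eps.
Proof. by rewrite /pot fweightX /fsize (esize_eqv (frepr_pi _)). Qed.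

Lemma pot_fI k t v : fI k t = Some v ->
  pot v = pot t + beta - Defs.mweight R s k - eps.
Proof.
move=> tv; rewrite /pot (fweightI _ _ _ tv) (fsizeI tv) mulrSr opprD !addrA.
by congr (_ - _); rewrite -!addrA; congr (_ + _); rewrite addrA addrC.
Qed.

Lemma pot_pow t n : pot (fpow t n) = pot t *+ n.
Proof. by elim: n => [|n IHn]; rewrite ?pot_fone //= potM IHn mulrS. Qed.

Lemma pot_prod (I : Type) (r : seq I) (F : I -> fexpr d) :
  pot (\big[@fmul d/fone d]_(i <- r) F i) = \sum_(i <- r) pot (F i).
Proof.
elim: r => [|i r IHr]; first by rewrite !big_nil pot_fone.
by rewrite !big_cons potM IHr.
Qed.

End Potential.

(** * Lower bounds from local subcriticality *)

Section Bounds.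
Variables (R : realType) (d : nat) (s : 'I_d -> nat) (alpha beta : R).
Variables (N : nat) (e : 'I_N -> nl_term R d).
Hypotheses (ss : is_scaling s) (alpha_lt0 : alpha < 0).
Hypothesis (xi_affine : forall j, (nt_xi (e j) <= 1)%N).
Hypothesis (e_sub : locally_subcritical s alpha beta e).
Local Notation wt := (fweight s alpha beta).

Lemma common_lower_bound (I : finType) (a : I -> R) : (forall i, 0 < a i) ->
  exists2 eps : R, 0 < eps & forall i, eps <= a i.
Proof.
move=> a0; suff [eps eps0 H] : exists2 eps : R, 0 < eps & forall i, i \in enum I -> eps <= a i.
  by exists eps => // i; apply: H; rewrite mem_enum.
elim: (enum I) => [|i r [eps eps0 IHr]]; first by exists 1.
exists (Num.min eps (a i)) => [|j]; first by rewrite lt_min eps0 a0.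
by rewrite inE => /predU1P[->|/IHr jr]; rewrite ge_min ?lexx ?orbT ?jr.
Qed.

(** Counts the factors of a term that may each cost [2 eps]. *)
Definition dummy_degree (t : nl_term R d) : nat :=
  ((if dummy_u alpha beta then odflt 0 (nt_u t) else 0)
   + \sum_(i | dummy_du s alpha beta i) odflt 0 (nt_du t i))%N.

(** There are finitely many strict inequalities, hence a common margin. The condition [eps <= 1]
    keeps the potential of [X_i] nonnegative, as [s i >= 1]. *)
Lemma small_eps : exists eps : R, [/\ 0 < eps, eps <= 1,
  ~~ dummy_u alpha beta -> eps *+ 2 <= beta + alpha,
  forall i, ~~ dummy_du s alpha beta i -> eps *+ 2 <= beta + alpha - (s i)%:R &
  forall j, nt_xi (e j) = 0%N ->
    (eps *+ 2) *+ dummy_degree (e j) <= dummy_homogeneity s alpha beta (e j) - alpha].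
Proof.
pose aU : R := if dummy_u alpha beta then 1 else (beta + alpha) / 2.
pose aP i : R := if dummy_du s alpha beta i then 1 else (beta + alpha - (s i)%:R) / 2.
(* The degree may be 0, hence the successor in the denominator. *)
pose aE j : R := if nt_xi (e j) == 0%N then
  (dummy_homogeneity s alpha beta (e j) - alpha) / 2 / (dummy_degree (e j)).+1%:R else 1.
have aU0 : 0 < aU by rewrite /aU /dummy_u; have [w0|w0] := leP (beta + alpha) 0;
  rewrite ?ltr01 ?divr_gt0.
have [e1 e10 e1P] : exists2 eps : R, 0 < eps & forall i, eps <= aP i.
  apply: common_lower_bound => i; rewrite /aP /dummy_du.
  by have [si|si] := leP (beta + alpha) (s i)%:R; rewrite ?ltr01 ?divr_gt0 ?subr_gt0.
have [e2 e20 e2P] : exists2 eps : R, 0 < eps & forall j, eps <= aE j.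
  apply: common_lower_bound => j; rewrite /aE; case: eqP => // j0.
  by have [_ _ /(_ j0) ?] := e_sub j; rewrite !divr_gt0 // subr_gt0.
pose eps := Num.min (Num.min 1 aU) (Num.min e1 e2).
have le1 : eps <= 1 by rewrite /eps !ge_min lexx.
have leU : eps <= aU by rewrite /eps !ge_min lexx orbT.
have leP' i : eps <= aP i by apply: le_trans (e1P i); rewrite /eps !ge_min lexx !orbT.
have leE j : eps <= aE j by apply: le_trans (e2P j); rewrite /eps !ge_min lexx !orbT.
have eps0 : 0 < eps by rewrite /eps !lt_min ltr01 aU0 e10 e20.
exists eps; split=> //.
- by move=> /negbTE nu; move: leU; rewrite /aU nu ler_pdivlMr // mulr_natr.
- by move=> i /negbTE ni; have := leP' i; rewrite /aP ni ler_pdivlMr // mulr_natr.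
- move=> j j0; have := leE j; rewrite /aE j0 eqxx ler_pdivlMr // ler_pdivlMr //.
  rewrite !mulr_natr => /(le_trans _); apply; rewrite mulrnAC lerMn2r /=.
  by rewrite mulrS lerDr ltW.
Qed.

Section WithEps.
Variable eps : R.
Hypotheses (eps0 : 0 < eps) (eps1 : eps <= 1).
Hypothesis eps_u : ~~ dummy_u alpha beta -> eps *+ 2 <= beta + alpha.
Hypothesis eps_du : forall i, ~~ dummy_du s alpha beta i ->
  eps *+ 2 <= beta + alpha - (s i)%:R.
Hypothesis eps_e : forall j, nt_xi (e j) = 0%N ->
  (eps *+ 2) *+ dummy_degree (e j) <= dummy_homogeneity s alpha beta (e j) - alpha.
Local Notation pot := (pot s alpha beta eps).

(** For [w = alpha + beta - |k|], a bound valid both for integrated symbols and for the monomials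
    [X^l]. The latter include the unit, of potential 0, so the bound cannot be positive. *)
Definition cbound (w : R) : R := if w <= 0 then w - eps *+ 2 else 0.

Lemma cbound_le0 w : cbound w <= 0.
Proof.
rewrite /cbound; case: ifP => // w0.
by rewrite subr_le0 (le_trans w0) // mulrn_wge0 // ltW.
Qed.

Lemma pot_poly_or_int k (W : set (fexpr d)) v :
  (0 < beta + alpha - Defs.mweight R s k ->
    eps *+ 2 <= beta + alpha - Defs.mweight R s k) ->
  (forall t, W t -> alpha - eps <= pot t) ->
  poly_or_int k W v -> cbound (beta + alpha - Defs.mweight R s k) <= pot v.
Proof.
move=> epsk WP [[l _ <-]|[t /WP tP tv]].
  apply: (le_trans (cbound_le0 _)); rewrite /fXpow pot_prod sumr_ge0 // => i _.
  rewrite pot_pow mulrn_wge0 // pot_fX subr_ge0 (le_trans eps1) // ler1n.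
  by have [s0 _] := ss.
rewrite (pot_fI _ _ _ _ tv) /cbound.
have [w0|/epsk epskw] := leP (beta + alpha - Defs.mweight R s k) 0.
  by rewrite mulr2n opprD; lra.
by move: epskw tP; rewrite mulr2n; lra.
Qed.

Let cU := cbound (beta + alpha).
Let cP (i : 'I_d) := cbound (beta + alpha - (s i)%:R).

(** Infinite exponents occur only for non-dummy variables, whose bound is 0. Without [Xi], lowering
    the exponent of a dummy variable only helps because its bound is nonpositive, so the full term
    is the worst case. If the term contains [Xi], it has no dummy factors and [m <= 1], which leaves
    [alpha - eps] or 0. *)
Lemma pot_subst j m q (k : mindex d) (U : set (fexpr d))
    (P : 'I_d -> set (fexpr d)) t : (m <= nt_xi (e j))%N -> le_exp q (nt_u (e j)) ->
  (forall i, le_exp (k i) (nt_du (e j) i)) ->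
  (forall u, U u -> cU <= pot u) -> (forall i u, P i u -> cP i <= pot u) ->
  subst_monomial m q k U P t -> alpha - eps <= pot t.
Proof.
move=> mj qj kj Ub Pb [u [p [Uu Pp ->]]].
have mulrn_sum (x : R) n : x *+ n = \sum_(i < n) x by rewrite sumr_const card_ord.
have lb : (alpha - eps) *+ m + cU *+ q + \sum_i cP i *+ k i <=
    pot (fmul (fmul (fpow (fXi d) m) (\big[@fmul d/fone d]_j u j))
               (\big[@fmul d/fone d]_i \big[@fmul d/fone d]_j p i j)).
  rewrite !potM pot_pow pot_fXi !pot_prod; apply: lerD; first apply: lerD => //.
    rewrite mulrn_sum; apply: ler_sum => i _; exact: Ub.
  apply: ler_sum => i _; rewrite pot_prod mulrn_sum.
  by apply: ler_sum => l _; exact: Pb.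
apply: le_trans lb.
have [[dU dP] hXi h0] := e_sub j.
have [j0|j0] := posnP (nt_xi (e j)).
  have m0 : m = 0%N by apply/eqP; rewrite -leqn0 -j0.
  rewrite m0 mulr0n add0r.
  have cUq : (if dummy_u alpha beta then (beta + alpha - eps *+ 2) *+ odflt 0%N (nt_u (e j)) else 0)
     <= cU *+ q.
    rewrite /cU /cbound -/(dummy_u _ _); case: ifPn => [du|_]; last by rewrite mul0rn.
    case: (nt_u (e j)) (dU du) qj => [q'|//] _ /= qq'.
    rewrite -(subnK qq') mulrnDr gerDr mulrn_wle0 //.
    by have := cbound_le0 (beta + alpha); rewrite /cbound -/(dummy_u _ _) du.
  have cPk : \sum_(i | dummy_du s alpha beta i)
      (beta + alpha - (s i)%:R - eps *+ 2) *+ odflt 0%N (nt_du (e j) i)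
     <= \sum_i cP i *+ k i.
    rewrite big_mkcond; apply: ler_sum => i _.
    rewrite /cP /cbound subr_le0 -/(dummy_du s _ _ i); case: ifPn => [di|_]; last by rewrite mul0rn.
    case: (nt_du (e j) i) (dP i di) (kj i) => [q'|//] _ /= qq'.
    rewrite -(subnK qq') mulrnDr gerDr mulrn_wle0 //.
    by have := cbound_le0 (beta + alpha - (s i)%:R); rewrite /cbound subr_le0 -/(dummy_du s _ _ i) di.
  have := eps_e j0; rewrite /dummy_homogeneity /dummy_degree mulrnDr.
  have E1 : (if dummy_u alpha beta then (beta + alpha - eps *+ 2) *+ odflt 0%N (nt_u (e j)) else 0)
      = (if dummy_u alpha beta then (beta + alpha) *+ odflt 0%N (nt_u (e j)) else 0)
        - (eps *+ 2) *+ (if dummy_u alpha beta then odflt 0%N (nt_u (e j)) else 0%N).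
    by case: ifP; rewrite ?mulrnBl ?subr0.
  have E2 : \sum_(i | dummy_du s alpha beta i)
      (beta + alpha - (s i)%:R - eps *+ 2) *+ odflt 0%N (nt_du (e j) i)
    = \sum_(i | dummy_du s alpha beta i)
        (beta + alpha - (s i)%:R) *+ odflt 0%N (nt_du (e j) i)
      - (eps *+ 2) *+ \sum_(i | dummy_du s alpha beta i) odflt 0%N (nt_du (e j) i).
    by rewrite -sumrMnr -sumrB; apply: eq_bigr => i _; rewrite mulrnBl.
  move: cUq cPk; rewrite {}E1 {}E2.
  (* What remains is linear arithmetic once these expressions are abstracted. *)
  move: (_ *+ (if _ then _ else _)) (_ *+ \sum_(_ | _) _) => x1 x2.
  move: (if _ then _ else _) (\sum_(_ | _) _) (cU *+ q) (\sum_i _ *+ _) => y1 y2 z1 z2.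
  by move: eps0; lra.
have [hU hP] := hXi j0.
have cUq : cU *+ q = 0.
  rewrite /cU /cbound -/(dummy_u _ _); case: ifPn => [/hU uE|_]; last exact: mul0rn.
  by move: qj; rewrite uE /= leqn0 => /eqP ->.
have cPk i : cP i *+ k i = 0.
  rewrite /cP /cbound subr_le0 -/(dummy_du s _ _ i).
  case: ifPn => [/hP uE|_]; last exact: mul0rn.
  by move: (kj i); rewrite uE /= leqn0 => /eqP ->.
rewrite cUq (eq_bigr _ (fun i _ => cPk i)) big1 // !addr0.
have : (m <= 1)%N by apply: leq_trans mj (xi_affine j).
by case: m {mj} => [|[|//]] _; rewrite ?mulr0n ?mulr1n ?lexx // subr_le0 ltW // (lt_trans alpha_lt0).
Qed.

Lemma pot_WUP n : [/\ forall t, Wset e n t -> alpha - eps <= pot t,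
  forall t, Uset e n t -> cU <= pot t & forall i t, Pset e n i t -> cP i <= pot t].
Proof.
elim: n => [|n [IW IU IP]]; first by split=> [t []|t []|i t []].
have IWn t : Wset e n.+1 t -> alpha - eps <= pot t.
  rewrite WsetS => -[/IW //|[m [q [k [[j [mj qj kj]] tS]]]]].
  exact: pot_subst mj qj kj IU IP tS.
split=> // [t|i t].
  rewrite UsetS => /(pot_poly_or_int _ IWn).
  rewrite mweight0 subr0 /cU; apply => w0.
  by apply: eps_u; rewrite /dummy_u -ltNge.
rewrite PsetS => /(pot_poly_or_int _ IWn).
rewrite mweight_munit /cP; apply => w0.
by apply: eps_du; rewrite /dummy_du -ltNge -subr_gt0.
Qed.

Lemma pot_FF t : FF e t -> Num.min (alpha - eps) cU <= pot t.
Proof.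
move=> [n _ Ft]; have [IW IU _] := pot_WUP n.
by rewrite ge_min; case: Ft => [/IW ->|/IU ->]; rewrite ?orbT.
Qed.

End WithEps.
Lemma flow_WUP n : [/\ forall t, Wset e n t -> flow t,
  forall t, Uset e n t -> flow t & forall i t, Pset e n i t -> flow t].
Proof.
have flow_poly_or_int k (W : set (fexpr d)) v : low_index k ->
    (forall t, W t -> flow t) -> poly_or_int k W v -> flow v.
  move=> kl Wl [[l _ <-]|[t /Wl tl tv]]; last by rewrite (flowI tv) kl.
  by apply: flow_prod => i; apply: flow_pow; exact: flow_fX.
elim: n => [|n [IW IU IP]]; first by split=> [t []|t []|i t []].
have IWn t : Wset e n.+1 t -> flow t.
  rewrite WsetS => -[/IW //|[m [q [k [_ [u [p [Uu Pp ->]]]]]]]].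
  rewrite !flowM flow_pow ?flow_fXi //= !flow_prod // => i; last exact: IU.
  by apply: flow_prod => j; exact: IP.
split=> // [t|i t].
  by rewrite UsetS; apply: flow_poly_or_int => //; rewrite /low_index eqxx.
rewrite PsetS; apply: flow_poly_or_int => //.
by apply/orP; right; apply/existsP; exists i.
Qed.

Lemma flow_FF t : FF e t -> flow t.
Proof.
move=> [n _ Ft]; have [IW IU _] := flow_WUP n.
by case: Ft => [/IW|/IU].
Qed.

Lemma finite_FF w : finite_set [set t | FF e t /\ wt t <= w].
Proof.
have [eps [eps0 eps1 epsu epsdu epse]] := small_eps.
pose C := Num.min (alpha - eps) (cbound eps (beta + alpha)).
pose n := Num.bound `|(w - C) / eps|.
apply: sub_finite_set (finite_size d n) => t [Ft tw]; split; first exact: flow_FF.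
have := pot_FF eps0 eps1 epsu epsdu epse Ft; rewrite -/C /pot => Ct.
have sn : (fsize t)%:R <= (w - C) / eps.
  by rewrite ler_pdivlMr // mulrC mulr_natr; move: Ct tw; lra.
rewrite -(ler_nat R); apply: (le_trans sn); apply: (le_trans (ler_norm _)).
exact: ltW (archi_boundP (normr_ge0 _)).
Qed.

Lemma FF_lbound : exists w, forall t, FF e t -> w <= wt t.
Proof.
have [eps [eps0 eps1 epsu epsdu epse]] := small_eps.
exists (Num.min (alpha - eps) (cbound eps (beta + alpha))) => t Ft.
apply: (le_trans (pot_FF eps0 eps1 epsu epsdu epse Ft)).
by rewrite /pot gerBl mulrn_wge0 // ltW.
Qed.

End Bounds.

(** * The regularity structure *)

HB.instance Definition _ (R : realType) n := Complete.on 'rV[R]_n.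

Section SpanTypes.
Variables (R : realType) (V : lmodType R) (S : set V).
Implicit Types a b : span_type S.

Lemma span_valP a : lspan S (val a).
Proof. by case: a => x /= /asboolP. Qed.

Definition mkspan (x : V) : span_type S := insubd (0 : span_type S) x.

Lemma mkspanK x : lspan S x -> val (mkspan x) = x.
Proof. by move=> Sx; apply: insubdK; exact/asboolP. Qed.

Lemma span_val_linear : linear (val : span_type S -> V).
Proof. by move=> c a b; rewrite linearP. Qed.

End SpanTypes.

(* [T] will be [HF e]; it is kept abstract because unfolding [HF e] makes
   conversion intractable. *)
Section GradedSpace.
Variables (R : realType) (K : choiceType) (F : set K) (wt : K -> R) (k0 : K).
Variables (T : lmodType R) (v : {linear T -> malg K R}) (mk : malg K R -> T).
Hypotheses (v_inj : injective v) (v_supp : forall a, supp_in F (v a)).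
Hypothesis mkK : forall x, supp_in F x -> v (mk x) = x.
Implicit Types (t : K) (a b : T) (S : set K).

Definition bas t : T := mk (bvec R t).

Lemma basK t : F t -> v (bas t) = bvec R t.
Proof. by move=> Ft; apply: mkK; exact: supp_in_bvec. Qed.

Lemma v_sum (I : Type) (r : seq I) (f : I -> T) :
  v (\sum_(i <- r) f i) = \sum_(i <- r) v (f i).
Proof. exact: raddf_sum. Qed.

Lemma vZ (c : R) a : v (c *: a) = c *: v a.
Proof. exact: linearZ_LR. Qed.

Lemma mcoeff_sum t (I : Type) (r : seq I) (f : I -> T) :
  mcoeff t (v (\sum_(i <- r) f i)) = \sum_(i <- r) mcoeff t (v (f i)).
Proof. by rewrite v_sum raddf_sum. Qed.

Lemma supp_in_notin t S x : supp_in S x -> ~ S t -> mcoeff t x = 0 :> R.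
Proof. by move=> Sx St; apply/eqP; apply: contra_notT St => /Sx. Qed.

Lemma vP a b : (forall t, F t -> mcoeff t (v a) = mcoeff t (v b)) -> a = b.
Proof.
move=> ab; apply: v_inj; apply/malgP => t.
have [/ab //|Ft] := pselect (F t).
by rewrite !(supp_in_notin _ Ft).
Qed.

Lemma v_eq0 a : (forall t, mcoeff t (v a) = 0) -> a = 0.
Proof. by move=> a0; apply: vP => t _; rewrite a0 linear0 mcoeff0. Qed.

Lemma lspan_bas (C : set T) a :
  (forall t, mcoeff t (v a) != 0 -> C (bas t)) -> lspan C a.
Proof.
move=> aC; pose r := msupp (v a).
exists (size r), (fun i => mcoeff (tnth (in_tuple r) i) (v a)).
exists (fun i => bas (tnth (in_tuple r) i)); split=> [i|].
  by apply: aC; rewrite mcoeff_neq0; exact: mem_tnth.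
rewrite -(big_tnth _ _ r xpredT (fun t => mcoeff t (v a) *: bas t)).
apply: v_inj; rewrite v_sum [LHS]malg_bvecE; apply: eq_big_seq => t.
by rewrite -mcoeff_neq0 => /v_supp Ft; rewrite vZ basK.
Qed.

(** Gives both the homogeneous components of an element and its splitting along a sector. *)
Definition restrict S a : T :=
  mk (linext (fun t => if `[< S t >] then bvec R t else 0) (v a)).

Lemma mcoeff_restrict S a t :
  mcoeff t (v (restrict S a)) = if `[< S t >] then mcoeff t (v a) else 0.
Proof.
rewrite mkK; last first.
  apply: (supp_in_linext _ (v_supp (a := a))) => u Fu.
  by case: ifP => _; [exact: supp_in_bvec|exact: supp_in0].
elim/malg_ind: (v a) => [|c x u IHx]; first by rewrite linear0 !mcoeff0 if_same.
rewrite linext_linear mcoeffD mcoeffZ IHx linext_bvec mcoeffD mcoeffZ mcoeff_bvec.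
have [->|ut] := eqVneq u t.
  by case: ifP => _; rewrite ?mcoeff_bvec ?eqxx // mcoeff0 mulr0 add0r.
by rewrite mulr0 add0r; case: ifP => _;
  rewrite ?mcoeff_bvec ?(negbTE ut) ?mcoeff0 mulr0 add0r.
Qed.

Lemma restrict_supp S a : supp_in S (v (restrict S a)).
Proof. by move=> t; rewrite mcoeff_restrict; case: asboolP => // _; rewrite eqxx. Qed.

Definition Fw (w : R) : set K := [set t | F t /\ wt t = w].

(** An enumeration of [Fw w] only if that set is finite, which [fin] guarantees from [mem_basis]
    on. *)
Definition basis (w : R) : seq K := fset_set (Fw w).

Definition comb (w : R) (x : 'rV[R]_(size (basis w))) : T :=
  \sum_i x ord0 i *: bas (nth k0 (basis w) i).

Definition coords w a : 'rV[R]_(size (basis w)) :=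
  \row_i mcoeff (nth k0 (basis w) i) (v a).

Local Notation A := (wt @` F).

Lemma comb_linear w : linear (@comb w).
Proof.
move=> c x y; rewrite /comb scaler_sumr -big_split; apply: eq_bigr => i _ /=.
by rewrite !mxE scalerDl scalerA.
Qed.

HB.instance Definition _ w := GRing.isLinear.Build R _ T *:%R (@comb w)
  (@comb_linear w).

Hypothesis fin : forall w, finite_set [set t | F t /\ wt t <= w].

Lemma mem_basis w t : t \in basis w <-> Fw w t.
Proof.
rewrite /basis in_fset_set ?inE //.
by apply: sub_finite_set (fin w) => u [eu <-]; split.
Qed.

Lemma basis_uniq w : uniq (basis w).
Proof. exact: fset_uniq. Qed.

Lemma nth_basis w (i : 'I_(size (basis w))) : Fw w (nth k0 (basis w) i).
Proof. by apply/mem_basis; exact: mem_nth. Qed.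

Lemma mcoeff_comb w x (i : 'I_(size (basis w))) :
  mcoeff (nth k0 (basis w) i) (v (comb x)) = x ord0 i.
Proof.
rewrite /comb mcoeff_sum (bigD1 i) //= vZ mcoeffZ.
rewrite basK; last by have [] := nth_basis i.
rewrite mcoeff_bvec eqxx mulr1 big1 ?addr0 // => j ji.
rewrite vZ mcoeffZ basK; last by have [] := nth_basis j.
by rewrite mcoeff_bvec nth_uniq ?basis_uniq // (negbTE ji : (j == i :> nat) = false) mulr0.
Qed.

Lemma comb_supp w (x : 'rV_(size (basis w))) : supp_in (Fw w) (v (comb x)).
Proof.
rewrite /comb v_sum; apply: supp_in_sum => i _ _; rewrite vZ.
by rewrite basK; [apply: supp_inZ; apply: supp_in_bvec; exact: nth_basis|have [] := nth_basis i].
Qed.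

Lemma comb_inj w : injective (@comb w).
Proof. by move=> x y xy; apply/rowP => i; rewrite -!mcoeff_comb xy. Qed.

Lemma comb_surj w a : supp_in (Fw w) (v a) ->
  comb (coords w a) = a.
Proof.
move=> aw; apply: vP => t _.
have [tw|tw] := boolP (t \in basis w).
  have ti : (index t (basis w) < size (basis w))%N by rewrite index_mem.
  by have := mcoeff_comb (coords w a) (Ordinal ti);
    rewrite mxE /= nth_index.
have coef0 b : supp_in (Fw w) (v b) -> mcoeff t (v b) = 0.
  by move=> bw; apply/eqP; apply: contraNT tw => /bw /mem_basis.
by rewrite !coef0 //; exact: comb_supp.
Qed.

Lemma range_comb w a : range (@comb w) a <-> supp_in (Fw w) (v a).
Proof.
split=> [[x _ <-]|aw]; first exact: comb_supp.
by exists (coords w a) => //; exact: comb_surj.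
Qed.

(** Coordinates with the supremum norm provide the Banach structure of [T_w]. *)
Definition Ew (w : R) : completeNormedModType R := 'rV[R]_(size (basis w)).
Definition io (w : R) : {linear Ew w -> T} := @comb w.

Lemma range_io w a : range (io w) a <-> supp_in (Fw w) (v a).
Proof. exact: range_comb. Qed.

(** If no symbol has weight [w], both sides say that [a] is 0. *)
Lemma homogP w a : homog A io w a <-> supp_in (Fw w) (v a).
Proof.
split=> [[->|[_ /range_io //]]|aw]; first by rewrite linear0; exact: supp_in0.
have [[t at0]|na] := pselect (exists t, mcoeff t (v a) != 0).
  by right; split; [exists t; case: (aw t at0)|apply/range_io].
left; apply: v_eq0 => t; apply/eqP; apply: contra_notT na => at0; by exists t.
Qed.

Lemma homog_bas w t : Fw w t -> homog A io w (bas t).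
Proof. by move=> tw; apply/homogP; rewrite basK; [exact: supp_in_bvec|case: tw]. Qed.

Lemma A_FF t : F t -> A (wt t).
Proof. by move=> et; exists t. Qed.

(** Components of different degrees have disjoint supports. Existence and uniqueness of the
    decomposition both follow coefficientwise. *)
Lemma mcoeff_direct_sum (f : R -> T) t :
  (forall w, A w -> range (io w) (f w)) -> (forall w, ~ A w -> f w = 0) ->
  finite_set [set w | f w != 0] ->
  mcoeff t (v (\sum_(w \in A) f w)) = mcoeff t (v (f (wt t))).
Proof.
move=> fA fnA ffin; pose r : seq R := fset_set [set w | f w != 0].
have memr w : (w \in r) = (f w != 0).
  by rewrite /r in_fset_set //; apply/idP/idP; rewrite inE.
have coef0 w : w != wt t -> mcoeff t (v (f w)) = 0.
  move=> wtw; have [/fA /range_io fw|/fnA ->] := pselect (A w); last first.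
    by rewrite linear0 mcoeff0.
  by apply/eqP; apply: contraNT wtw => /fw [_ ->].
rewrite (fsbigE r) ?fset_uniq //; last first.
- by move=> w _; rewrite memr negbK => /eqP.
- by move=> w /=; rewrite memr => fw; apply: contrapT => /fnA fw0; rewrite fw0 eqxx in fw.
rewrite -big_filter mcoeff_sum.
have [wr|wr] := boolP (wt t \in [seq w <- r | w \in A]).
  rewrite (bigD1_seq (wt t)) ?filter_uniq ?fset_uniq //= big1 ?addr0 // => w; exact: coef0.
rewrite big_seq big1 => [|w wr']; last first.
  by apply: coef0; apply: contraNneq wr => <-.
move: wr; rewrite mem_filter negb_and => /orP[|].
  by move=> /negP nA; rewrite fnA ?linear0 ?mcoeff0 // => /mem_set.
by rewrite memr negbK => /eqP ->; rewrite linear0 mcoeff0.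
Qed.

Lemma direct_sum_basis : direct_sum A (fun w => range (io w)).
Proof.
move=> a; pose f w := restrict (Fw w) a.
have fE w t : mcoeff t (v (f w)) = if `[< Fw w t >] then mcoeff t (v a) else 0.
  exact: mcoeff_restrict.
have fA w : range (io w) (f w).
  by apply/range_io => t; rewrite fE; case: asboolP => // _; rewrite eqxx.
have fnA w : ~ A w -> f w = 0.
  move=> nA; apply: v_eq0 => t; rewrite fE; case: asboolP => // -[et tw].
  by case: nA; rewrite -tw; exact: A_FF.
have ffin : finite_set [set w | f w != 0].
  apply: (@sub_finite_set _ _ (wt @` [set` msupp (v a)])); last first.
    exact/finite_image/finite_fset.
  move=> w; apply: contraPP => nw /=; apply/negP; rewrite negbK; apply/eqP.
  apply: v_eq0 => t; rewrite fE; case: asboolP => // -[et tw].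
  apply/eqP; apply: contra_notT nw => at0; exists t => //=.
  by rewrite -mcoeff_neq0.
exists f; split.
  split=> //; apply: vP => t et; rewrite mcoeff_direct_sum // fE.
  by case: asboolP => // -[].
move=> f' [f'A f'nA f'fin aE]; apply/funext => w; apply: vP => t et.
rewrite fE; case: asboolP => [[_ <-]|tw].
  by rewrite aE mcoeff_direct_sum.
have [/f'A /range_io fw|/f'nA ->] := pselect (A w); last by rewrite linear0 mcoeff0.
by apply/esym/eqP; apply: contra_notT tw => /fw.
Qed.

(** An intersection of kernels of coordinate forms, each of them continuous. *)
Lemma closed_coord w (D : set K) :
  closed (io w @^-1` [set a | supp_in D (v a)]).
Proof.
have -> : io w @^-1` [set a | supp_in D (v a)] =
    \bigcap_(i in [set i : 'I_(size (basis w)) | ~ D (nth k0 (basis w) i)])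
      ((fun x : Ew w => (x : 'rV_(size (basis w))) ord0 i) @^-1` [set 0]).
  apply/seteqP; split=> [x xD i /= Di|x xD t tx].
    by apply/eqP; apply: contra_notT Di; rewrite -mcoeff_comb => /xD.
  have /mem_basis tw : Fw w t by exact: (@comb_supp w x t tx).
  have ti : (index t (basis w) < size (basis w))%N by rewrite index_mem.
  apply: contrapT => Dt.
  have := xD (Ordinal ti); rewrite /= nth_index // => /(_ Dt).
  rewrite -mcoeff_comb /= nth_index // => tx0.
  by move: tx; rewrite [mcoeff _ _]tx0 eqxx.
apply: closed_bigI => i _; apply: preimage_closed; last exact: closed_eq.
by move=> x _; exact: coord_continuous.
Qed.

Lemma A_locally_finite (x y : R) : finite_set (A `&` `[x, y]).
Proof.
apply: sub_finite_set (finite_image wt (fin y)) => w [[t Ft <-]].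
by rewrite /= in_itv /= => /andP[_ ty]; exists t.
Qed.

Lemma lspan_lower w a : supp_in [set t | F t /\ wt t < w] (v a) ->
  lspan (\bigcup_(b in [set b | A b /\ b < w]) homog A io b) a.
Proof.
move=> aw; apply: lspan_bas => t /aw [Ft tw]; exists (wt t); last exact: homog_bas.
by split=> //; exact: A_FF.
Qed.

Lemma norm_row1 n : n = 1%N -> `|const_mx 1 : 'rV[R]_n| = 1.
Proof.
move=> ->; rewrite [LHS]/Num.Def.normr /= mx_normrE.
apply/eqP; rewrite eq_le; apply/andP; split.
  by apply: bigmax_le => // i _; rewrite mxE normr1.
by apply/bigmax_geP; right; exists (ord0, ord0) => //=; rewrite mxE normr1.
Qed.

(** Uniqueness of the symbol of weight 0 makes [Ew 0] one-dimensional, and the constant row 1 has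
    norm 1. *)
Lemma unit_space : F k0 -> wt k0 = 0 -> (forall t, F t -> wt t = 0 -> t = k0) ->
  exists u : Ew 0, [/\ io 0 u = bas k0, `|u| = 1 & forall x : Ew 0, exists c : R, x = c *: u].
Proof.
move=> Fk0 k00 Funiq.
have basis1 : basis 0 = [:: k0].
  apply: perm_small_eq => //; apply: uniq_perm => //; first exact: basis_uniq.
  move=> t; rewrite inE; apply/idP/eqP => [/mem_basis[Ft t0]|->]; first exact: Funiq.
  by apply/mem_basis.
have size1 : size (basis 0) = 1%N by rewrite basis1.
(* The dimension is 1 only up to a proved equality, so the claim is stated for a variable [n]. *)
have ordE n (i j : 'I_n) : n = 1%N -> i = j.
  by move=> n1; move: i j; rewrite n1 => i j; rewrite [i]ord1 [j]ord1.
have nthE (i : 'I_(size (basis 0))) : nth k0 (basis 0) i = k0.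
  by have [Fi wi] := nth_basis i; exact: Funiq.
exists (const_mx 1); split.
- rewrite -[RHS](@comb_surj 0); last by rewrite basK //; exact: supp_in_bvec.
  congr (comb _); apply/rowP => i; rewrite !mxE nthE basK //.
  by rewrite mcoeff_bvec eqxx.
- exact: norm_row1.
- move=> x; have i0 : 'I_(size (basis 0)) by rewrite size1; exact: ord0.
  exists (x ord0 i0); apply/rowP => i; rewrite !mxE mulr1; congr (x _ _).
  exact: ordE.
Qed.

Section Sector.
Variables (S : set K) (G : set (T -> T)).
Hypothesis SF : S `<=` F.
Hypothesis A_lb : exists c, forall t, F t -> c <= wt t.
Hypothesis S_inv : forall Gam a, G Gam -> supp_in S (v a) -> supp_in S (v (Gam a)).

Lemma subspace_supp (D : set K) : is_subspace [set a | supp_in D (v a)].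
Proof.
split=> [|c x y xD yD] /=; first by rewrite linear0; exact: supp_in0.
by rewrite linearP; apply: supp_inD => //; exact: supp_inZ.
Qed.

(** In each degree the complement is spanned by the symbols outside [S]. *)
Lemma sector_supp : is_sector A io G [set a | supp_in S (v a)].
Proof.
split.
- exact: subspace_supp.
- move=> a aS; apply: lspan_bas => t /aS St; exists (wt t); first exact/A_FF/SF.
  split; last by apply: homog_bas; split=> //; exact: SF.
  by rewrite /= basK; [exact: supp_in_bvec|exact: SF].
- have [c cA] := A_lb; exists c => w wc a [_ [//|[[t Ft tw] _]]].
  by have := cA t Ft; rewrite tw leNgt wc.
- move=> w Aw; exists [set a | supp_in (Fw w `\` S) (v a)]; split.
  + split; first exact: subspace_supp.
    move=> a aW; apply/homogP; apply: supp_inW aW => t; exact: subDsetl.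
  + move=> a /homogP aw; exists (restrict S a), (restrict (Fw w `\` S) a); split.
    * exact: restrict_supp.
    * exact: restrict_supp.
    * apply: vP => t Ft; rewrite linearD mcoeffD !mcoeff_restrict.
      case: asboolP => St; first by rewrite asboolF ?addr0 // => -[].
      case: asboolP => tw; first by rewrite add0r.
      by rewrite addr0 (supp_in_notin aw) // => tw'; apply: tw.
  + move=> a [aS aW]; apply: v_eq0 => t; apply/eqP; apply: contrapT => /negP at0.
    by have [_] := aW t at0; apply; exact: aS.
  + exact: closed_coord.
  + exact: closed_coord.
- exact: S_inv.
Qed.

End Sector.
End GradedSpace.

(** * The space [H_F] and its group of operators *)

Section ModelSpace.
Variables (R : realType) (d : nat) (N : nat) (e : 'I_N -> nl_term R d).
Local Notation HF := (HF e).

Definition vHF (a : HF) : malg (fexpr d) R := val a.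

Lemma vHF_linear : linear vHF.
Proof. exact: span_val_linear. Qed.

HB.instance Definition _ :=
  GRing.isLinear.Build R HF (malg (fexpr d) R) *:%R vHF vHF_linear.

Lemma vHF_inj : injective vHF.
Proof. exact: val_inj. Qed.

Lemma vHF_supp a : supp_in (FF e) (vHF a).
Proof. exact/lspan_bvecP/span_valP. Qed.

Definition mkHF (x : malg (fexpr d) R) : HF := mkspan _ x.

Lemma mkHFK x : supp_in (FF e) x -> vHF (mkHF x) = x.
Proof. by move=> ex; apply: mkspanK; exact/lspan_bvecP. Qed.

Lemma valHFB a b : vHF (a - b) = vHF a - vHF b.
Proof. exact: raddfB. Qed.

Lemma HFspanP S (a : HF) : HFspan S a <-> supp_in S (vHF a).
Proof. exact: lspan_bvecP. Qed.

Lemma UsetFF n t : Uset e n t -> FF e t.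
Proof. by move=> Ut; exists n => //; right. Qed.

Lemma polys_FF : @polys d `<=` FF e.
Proof. by move=> t tp; apply: (@UsetFF 1%N); rewrite UsetS; left. Qed.

Lemma Wall_FF : Wall e `<=` FF e.
Proof. by move=> t [n _ Wt]; exists n => //; left. Qed.

Lemma fI_Wall t v : Wall e t -> fI 0 t = Some v -> FF e v.
Proof.
move=> [[//|n] _ Wt] tv; apply: (@UsetFF n.+1); rewrite UsetS; right.
by exists t.
Qed.

Section Group.
Variables (s : 'I_d -> nat) (alpha beta : R).
Hypothesis ss : is_scaling s.
Local Notation Hplus := (Hplus s alpha beta).
Local Notation GF := (GF s alpha beta e).

Lemma GammaGm (g : {linear Hplus -> R^o}) x : Gamma g x = Gm g x.
Proof. exact: GammaE. Qed.

Lemma restrictsP (g : {linear Hplus -> R^o}) (Gam : HF -> HF) :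
  restricts g Gam <-> forall a, vHF (Gam a) = Gm g (vHF a).
Proof.
by split=> gG a; [rewrite -GammaGm; exact: gG|rewrite GammaGm; exact: gG].
Qed.

Lemma restricts_exists (g : Hplus -> R) : character g ->
  exists Gam : HF -> HF, restricts g Gam.
Proof.
move=> /charP[g' [-> gm]]; exists (fun a => mkHF (Gm g' (vHF a))).
apply/restrictsP => a; apply: mkHFK.
by apply: Gm_supp; [exact: FF_invariant|exact: vHF_supp].
Qed.

Lemma gmul_action (g h : Hplus -> R) : character g -> character h ->
  character (gmul g h) /\ forall x, Gamma (gmul g h) x = Gamma g (Gamma h x).
Proof.
move=> /charP[g' [-> gm]] /charP[h' [-> hm]].
have ghc : character (gmul g' h') by exact: gmul_character.
split; first exact: ghc.
move=> x; have [f [fE _]] := charP ghc.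
rewrite [in LHS]fE !GammaGm; exact: Gm_gmul.
Qed.

Lemma GF_Gm Gam : GF Gam -> exists2 g : {linear Hplus -> R^o},
  monoid_morphism g & forall a, vHF (Gam a) = Gm g (vHF a).
Proof. by move=> [g /charP[g' [-> gm]] /restrictsP]; exists g'. Qed.

Lemma Gm_GF (g : {linear Hplus -> R^o}) Gam : monoid_morphism g ->
  (forall a, vHF (Gam a) = Gm g (vHF a)) -> GF Gam.
Proof.
move=> gm gG; exists g; last exact/restrictsP.
by split=> // c x y; exact: linearP.
Qed.

Lemma GF_exists (g : {linear Hplus -> R^o}) : monoid_morphism g ->
  exists Gam : HF -> HF, forall a, vHF (Gam a) = Gm g (vHF a).
Proof.
move=> gm; exists (fun a => mkHF (Gm g (vHF a))) => a; apply: mkHFK.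
by apply: Gm_supp; [exact: FF_invariant|exact: vHF_supp].
Qed.

Lemma GF_linear Gam : GF Gam -> linear Gam.
Proof.
move=> /GF_Gm[g gm gG] c x y; apply: vHF_inj.
by rewrite gG vHF_linear GmD GmZ vHF_linear !gG.
Qed.

Lemma GF_comp Gam Gam' : GF Gam -> GF Gam' -> GF (Gam \o Gam').
Proof.
move=> /GF_Gm[g gm gG] /GF_Gm[h hm hG].
have [f [fE fm]] := charP (gmul_character gm hm).
apply: (Gm_GF fm) => a.
by rewrite /= gG hG; apply/esym; exact: Gm_gmul.
Qed.

Lemma right_inverse_exists (g : {linear Hplus -> R^o}) : monoid_morphism g ->
  exists2 h : {linear Hplus -> R^o}, monoid_morphism h & cancel (Gm h) (Gm g).
Proof.
move=> gm; have [h [hE hm]] := charP (char_of_character (inv_gen g)).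
by exists h => // x; exact: Gm_ginvK.
Qed.

(** The identity arises as the product of some character with its right inverse, so the action of
    the counit need not be computed. *)
Lemma GF_id : GF idfun.
Proof.
have [g [_ gm]] := charP (char_of_character (fun _ : pgen s alpha beta => 0)).
have [h hm hK] := right_inverse_exists gm.
have [f [fE fm]] := charP (gmul_character gm hm).
apply: (Gm_GF fm) => a.
by rewrite (Gm_gmul ss gm hm _ fE) hK.
Qed.

(* A right inverse of a right inverse is the operator itself. *)
Lemma GF_inv Gam : GF Gam -> exists2 Gam', GF Gam' & cancel Gam Gam' /\ cancel Gam' Gam.
Proof.
move=> /GF_Gm[g gm gG].
have [h hm hK] := right_inverse_exists gm.
have [k km kK] := right_inverse_exists hm.
have [Gam' hG] := GF_exists hm.
exists Gam'; first exact: Gm_GF hG.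
have gk x : Gm g x = Gm k x by apply: etrans (congr1 (Gm g) (esym (kK x))) _; exact: hK.
split=> a; apply: vHF_inj.
  by rewrite hG gG gk; exact: kK.
by rewrite gG hG; exact: hK.
Qed.

Section Structure.
Hypothesis alpha_lt0 : alpha < 0.
Hypothesis xi_affine : forall j, (nt_xi (e j) <= 1)%N.
Hypothesis e_sub : locally_subcritical s alpha beta e.
Hypothesis zero_weight : forall t, FF e t -> fweight s alpha beta t = 0 -> t = fone d.
Local Notation wt := (fweight s alpha beta).
Local Notation AF := (AF s alpha beta e).

Let fin := finite_FF ss alpha_lt0 xi_affine e_sub.
Let lb := FF_lbound ss alpha_lt0 xi_affine e_sub.

Definition ioF (w : R) : {linear Ew (FF e) wt w -> HF} := io (FF e) wt (fone d) mkHF w.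

Definition oneF : HF := mkHF (bvec R (fone d)).

Lemma FF_fone : FF e (fone d).
Proof. exact/polys_FF/polys_fone. Qed.

Lemma vHF_one : vHF oneF = bvec R (fone d).
Proof. by apply: mkHFK; apply: supp_in_bvec; exact: FF_fone. Qed.

Lemma homogFP w a : homog AF ioF w a <-> supp_in (Fw (FF e) wt w) (vHF a).
Proof. exact: (homogP _ vHF_inj vHF_supp mkHFK fin). Qed.

Lemma range_ioF w a : range (ioF w) a <-> supp_in (Fw (FF e) wt w) (vHF a).
Proof. exact: (range_io _ vHF_inj vHF_supp mkHFK fin). Qed.

Lemma regularity_structure : is_regularity_structure AF ioF oneF GF.
Proof.
split.
- by exists (fone d); [exact: FF_fone|exact: fweight1].
- have [c cP] := lb; by exists c => w [t /cP ct <-].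
- exact: A_locally_finite.
- move=> w _; exact: (comb_inj mkHFK fin).
- exact: (direct_sum_basis _ vHF_inj vHF_supp mkHFK fin).
- exact: (unit_space vHF_inj vHF_supp mkHFK fin FF_fone (fweight1 _ _ _) zero_weight).
- exact: GF_linear.
- exact: GF_id.
- exact: GF_comp.
- exact: GF_inv.
- move=> Gam /GF_Gm[g gm gG]; apply: vHF_inj.
  by rewrite gG vHF_one (Gm_fone ss gm) bvec_fone.
- move=> Gam w a GGam Aw /homogFP aw.
  apply: (lspan_lower (fone d) vHF_inj vHF_supp mkHFK fin).
  have [g gm gG] := GF_Gm GGam.
  move=> t tc; split; first exact: vHF_supp tc.
  have : mcoeff t (vHF (Gam a - a)) != 0 by exact: tc.
  rewrite valHFB gG; apply: Gm_sub_ltw => // u ua; by case: (aw u ua).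
Qed.

(** [mkHF] returns 0 on vectors outside [H_F]; on [VF] this default is never reached. *)
Definition IF (a : HF) : HF := mkHF (HI 0 (vHF a)).

Lemma IF_val a : VF e a -> vHF (IF a) = HI 0 (vHF a).
Proof.
move=> /HFspanP aW; apply: mkHFK; apply: supp_in_HI aW => t v; exact: fI_Wall.
Qed.

Lemma integration_map :
  is_abstract_integration_map AF ioF GF (TFbar e) beta (VF e) IF.
Proof.
have VE : VF e = [set a | supp_in (Wall e) (vHF a)].
  by apply/seteqP; split=> a /HFspanP.
split.
- rewrite VE; apply: (sector_supp _ vHF_inj vHF_supp mkHFK fin Wall_FF lb).
  move=> Gam a /GF_Gm[g gm gG] aW.
  suff : supp_in (Wall e) (vHF (Gam a)) by [].
  rewrite gG; by apply: Gm_supp aW; exact: Wall_invariant.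
- move=> c x y xV yV; apply: vHF_inj; rewrite vHF_linear !IF_val //; last first.
    move: xV yV; rewrite VE /= => xV yV; rewrite vHF_linear.
    by apply: supp_inD => //; exact: supp_inZ.
  by rewrite vHF_linear; exact: linearP.
- move=> w a aV /homogFP aw; apply/homogFP; rewrite IF_val //.
  move: aV; rewrite VE /= => aW.
  apply: (@supp_in_HI _ _ _ (Wall e `&` [set t | wt t = w])) => [t v [Wt tw] tv|t at0].
    split; first exact: fI_Wall Wt tv.
    by rewrite (fweightI _ _ _ tv) mweight0 subr0 tw.
  by split; [exact: aW|case: (aw t at0)].
- move=> a aV /HFspanP ap; apply: vHF_inj; rewrite IF_val // [RHS]linear0.
  by apply: HI_fmono; apply: supp_inW ap => t; exact: polys_fmono.
- move=> Gam a GGam aV; apply/HFspanP; have [g gm gG] := GF_Gm GGam.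
  have GaV : VF e (Gam a).
    move: aV; rewrite VE /= gG => aW; apply: Gm_supp aW; exact: Wall_invariant.
  (* The commutator equals [- Gpoly g 0 a], a polynomial. *)
  rewrite valHFB IF_val // !gG IF_val // (GmI ss gm) opprD addNKr.
  by apply: supp_inN; exact: Gpoly_polys.
Qed.

End Structure.

End Group.
End ModelSpace.

Theorem theorem8p24 (R : realType) (d : nat) (s : 'I_d -> nat) (alpha beta : R)
    (F : R -> 'rV[R]_d -> R -> R) (N : nat) (e : 'I_N -> nl_term R d) :
  is_scaling s -> 0 < beta -> alpha < 0 ->
  smooth (fun x : R * 'rV[R]_d * R => F x.1.1 x.1.2 x.2) ->
  is_expression F e ->
  locally_subcritical s alpha beta e ->
  (forall t, FF e t -> fweight s alpha beta t = 0 -> t = fone d) ->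
  (* [G] acts on [H_F], and its product is the composition of operators *)
  [/\ forall g : Hplus s alpha beta -> R, character g ->
        exists Gam : HF e -> HF e, restricts g Gam,
      forall g h : Hplus s alpha beta -> R, character g -> character h ->
        character (gmul g h) /\
        forall x, Gamma (gmul g h) x = Gamma g (Gamma h x) &
      exists (E : R -> completeNormedModType R)
             (io : forall g, {linear E g -> HF e}) (one : HF e) (I : HF e -> HF e),
        [/\ (forall g, AF s alpha beta e g -> range (io g) = TF s alpha beta e g),
            val one = bvec R (fone d),
            is_regularity_structure (AF s alpha beta e) io one (GF s alpha beta e),
            (forall a, VF e a -> val (I a) = HI 0 (val a)) &
            is_abstract_integration_map (AF s alpha beta e) io (GF s alpha beta e)
              (TFbar e) beta (VF e) I]].
Proof.
move=> ss _ alpha_lt0 _ [e_ok _] e_sub zero_weight.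
have xi_affine j : (nt_xi (e j) <= 1)%N by exact: nt_affine (e_ok j).
split; first by move=> g; exact: restricts_exists.
  by move=> g h; exact: gmul_action.
exists (Ew (FF e) (fweight s alpha beta)), (ioF e s alpha beta), (oneF e), (@IF _ _ _ e).
split.
- move=> w _; apply/seteqP; split=> a.
    by move/(range_ioF ss alpha_lt0 xi_affine e_sub) => aw; exact/HFspanP.
  by move/HFspanP => aw; exact/(range_ioF ss alpha_lt0 xi_affine e_sub).
- exact: vHF_one.
- exact: regularity_structure.
- exact: IF_val.
- exact: integration_map.
Qed.
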